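(* Let $\gamma_1,\gamma_2,\gamma_3,\delta_1,\delta_2,\delta_3\in\mathbb{C}$ and let $\alpha_1,\dots,\alpha_4,\beta_1,\dots,\beta_4$ be positive real numbers. Consider the double power series in $x,y\in\mathbb{C}$ $$D_1(x,y)=\sum_{m,n=0}^{\infty}\frac{(\gamma_1)_{\alpha_1 m+\beta_1 n}(\gamma_2)_{\alpha_2 m}(\gamma_3)_{\beta_2 n}}{\Gamma(\delta_1+\alpha_3 m+\beta_3 n)}\,\frac{x^m}{\Gamma(\delta_2+\alpha_4 m)}\,\frac{y^n}{\Gamma(\delta_3+\beta_4 n)}.$$ Put $\Delta=\alpha_3+\alpha_4-\alpha_1-\alpha_2$, $\Delta'=\beta_3+\beta_4-\beta_1-\beta_2$, and for $\mu,\nu>0$ $$E(\mu,\nu)=\mu^{\alpha_4-\alpha_2}\,\frac{(\alpha_3\mu+\beta_3\nu)^{\alpha_3}\,\alpha_4^{\alpha_4}}{(\alpha_1\mu+\beta_1\nu)^{\alpha_1}\,\alpha_2^{\alpha_2}},\qquad E'(\mu,\nu)=\nu^{\beta_4-\beta_2}\,\frac{(\alpha_3\mu+\beta_3\nu)^{\beta_3}\,\beta_4^{\beta_4}}{(\alpha_1\mu+\beta_1\nu)^{\beta_1}\,\beta_2^{\beta_2}},$$ $$\rho=\inf_{\mu,\nu>0}E(\mu,\nu),\qquad \rho'=\inf_{\mu,\nu>0}E'(\mu,\nu).$$ Then: (1) if $\Delta>0$ and $\Delta'>0$, the series converges for all $x,y\in\mathbb{C}$; (2) if $\Delta=0$ and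 $\Delta'=0$, the series converges absolutely for $|x|<\rho$ and $|y|<\rho'$; (3) if $\Delta<0$ and $\Delta'<0$, the series converges only at the point $x=y=0$; (4) if $\Delta=0$ and $\Delta'>0$, the series converges absolutely for $|x|<\rho$ and $|y|<\infty$; (5) if $\Delta>0$ and $\Delta'=0$, the series converges absolutely for $|x|<\infty$ and $|y|<\rho'$.
   Context: $(\gamma)_\lambda=\Gamma(\gamma+\lambda)/\Gamma(\gamma)$ denotes the (generalized) Pochhammer symbol for $\gamma\in\mathbb{C}$ and real $\lambda\ge 0$; $1/\Gamma$ is taken as the entire function, vanishing at the nonpositive integers.
   Formalization: Part (3) is proved assuming none of γ1, γ2, γ3, δ2, δ3 is a nonpositive integer; otherwise it fails (e.g. δ2=0 makes every term with m=0 vanish, so the series converges at all (0,y)). In (1) and (3) ''converges'' means convergence of rectangular partial sums. *)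

(* Defs.v *)
From Stdlib Require Import Reals Arith ClassicalEpsilon.
From Coquelicot Require Import Coquelicot.

Open Scope R_scope.

Definition nonpos_int (z : C) : Prop := exists k : nat, z = RtoC (- INR k).

Definition Cexp (z : C) : C :=
  (exp (Re z) * cos (Im z), exp (Re z) * sin (Im z)).

(* z (z + 1) ... (z + n - 1) *)
Fixpoint rising (z : C) (n : nat) : C :=
  match n with
  | O => RtoC 1
  | S n' => (rising z n' * (z + RtoC (INR n')))%C
  end.

(* The entire function 1/Gamma, by Gauss's formula
   1/Gamma(z) = lim_n  z (z + 1) ... (z + n) / (n! n^z). *)
Definition rGamma_seq (z : C) (n : nat) : C :=
  (rising z (S n) / RtoC (INR (fact n)) * Cexp (- z * RtoC (ln (INR n))))%C.

Definition rGamma (z : C) : C :=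
  (real (Lim_seq (fun n => Re (rGamma_seq z n))),
   real (Lim_seq (fun n => Im (rGamma_seq z n)))).

(* (g)_l = Gamma(g + l) / Gamma(g).  When g and g + l are both poles of Gamma,
   l is a natural number and the quotient has the limit g (g + 1) ... (g + l - 1);
   in particular (g)_0 = 1 for every g.  When only g + l is a pole the symbol is
   undefined; it then gets the value 0, since / 0 = 0 in C.  For g fixed this
   happens for l in a bounded set only. *)
Definition poch (g : C) (l : R) : C :=
  if excluded_middle_informative
       (nonpos_int g /\ nonpos_int (g + RtoC l)%C)
  then rising g (Z.to_nat (Int_part l))
  else (rGamma g / rGamma (g + RtoC l))%C.

(* Convergence of a double series in Pringsheim's sense: the rectangular partial
   sums converge when both bounds tend to infinity independently.  For real
   nonnegative terms this is the same as summability of the family. *)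
Definition is_double_series {K : AbsRing} {V : NormedModule K}
    (a : nat -> nat -> V) (s : V) : Prop :=
  filterlim (fun p : nat * nat => sum_n (fun m => sum_n (a m) (snd p)) (fst p))
    (filter_prod eventually eventually) (locally s).

Definition ex_double_series {K : AbsRing} {V : NormedModule K}
    (a : nat -> nat -> V) : Prop :=
  exists s : V, is_double_series a s.

Definition abs_cv_double_series (a : nat -> nat -> C) : Prop :=
  ex_double_series (fun m n => Cmod (a m n)).

Definition D1_term (g1 g2 g3 d1 d2 d3 : C)
    (a1 a2 a3 a4 b1 b2 b3 b4 : R) (x y : C) (m n : nat) : C :=
  (poch g1 (a1 * INR m + b1 * INR n) * poch g2 (a2 * INR m) * poch g3 (b2 * INR n)
   * rGamma (d1 + RtoC (a3 * INR m + b3 * INR n))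
   * (x ^ m * rGamma (d2 + RtoC (a4 * INR m)))
   * (y ^ n * rGamma (d3 + RtoC (b4 * INR n))))%C.

Definition E (a1 a2 a3 a4 b1 b3 : R) (mu nu : R) : R :=
  Rpower mu (a4 - a2)
  * ((Rpower (a3 * mu + b3 * nu) a3 * Rpower a4 a4)
     / (Rpower (a1 * mu + b1 * nu) a1 * Rpower a2 a2)).

Definition E' (a1 a3 b1 b2 b3 b4 : R) (mu nu : R) : R :=
  Rpower nu (b4 - b2)
  * ((Rpower (a3 * mu + b3 * nu) b3 * Rpower b4 b4)
     / (Rpower (a1 * mu + b1 * nu) b1 * Rpower b2 b2)).

Definition inf_pos_quadrant (F : R -> R -> R) : Rbar :=
  Glb_Rbar (fun r => exists mu nu : R, 0 < mu /\ 0 < nu /\ r = F mu nu).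

(* Main.v *)
Require Import Defs.
From Stdlib Require Import Reals Arith Lra Lia Psatz Classical ClassicalEpsilon.
From Coquelicot Require Import Coquelicot.

Open Scope R_scope.

(** Write [Phi t = t ln t - t], the leading part of [ln Gamma t].  A weak form
    of Stirling's formula, [ln |1/Gamma(g + l)| = - Phi l + o(l)] as the real
    number [l] tends to infinity ([rGamma_stirling]), is all that is needed
    about the growth of Gamma.  It is obtained without the integral: the functional equation
    carries [g + l] down to the strip [2 <= Re z <= 3], where Gauss's product
    stays between two positive constants ([rGamma_strip]), and the finite
    product of the factors [z + k] met on the way is compared with a telescoping
    sum by the convexity of [Phi] ([rising_bounds]).  Gauss's product itself
    converges because its consecutive quotients are [1 + O(1/n^2)]
    ([gauss_factor_bound], [slowly_varying_seq]).

    Hence the logarithm of the modulus of the general term at [(m, n)] is, up to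
    [o(m + n)],
      [W(m, n) + m ln |x| + n ln |y|],
    where [W] is the sum of the six [Phi]'s with their signs.  The identity
      [W(m, n) = m (Delta - ln E(m, n)) + n (Delta' - ln E'(m, n))]
    ([growth_exponent_eq]) explains the functions [E] and [E'].  Each of the two
    summands can be treated alone.  If [Delta = 0] and [|x| < rho], then
    [m (ln |x| - ln E)] is at most [- eta m].  If [Delta > 0], then [ln E] falls
    short of [Delta ln m] by at most a multiple of [ln (1 + n / m)] plus a
    constant, and [m ln (1 + n / m)] is at most [eps n + C m]; so the first summand,
    increased by [m ln |x|], stays below [- m + eps n + C] for every [x] and [eps].
    Both possibilities have the form called [tame] below.  Two tame directions
    together bound the term by a geometric double sequence, and the series converges together with its
    absolute values ([ex_double_series_geom]).  This gives the four convergence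
    statements at once.

    For the divergence, [Phi (c k) = c k ln k + O(k)] shows that along the ray
    [(p k, q k)] the logarithm of the term is [- (Delta p + Delta' q) k ln k + O(k)],
    which tends to [+oo].  Convergence in Pringsheim's sense only forces whole
    rows and whole columns of rectangular partial sums to become small
    ([double_series_tails]); the ray is the diagonal when [x] and [y] are both
    nonzero, and otherwise the axis on which the remaining variable lives, where
    a row or column sum reduces to a single term. *)

(** * The factors of Gauss's product *)

Lemma exp_le (x y : R) : x <= y -> exp x <= exp y.
Proof.
  intros [h|h]; [now apply Rlt_le, exp_increasing|now rewrite h; apply Rle_refl].
Qed.

Lemma Cmod_Cexp (z : C) : Cmod (Cexp z) = exp (Re z).
Proof.
  unfold Cexp, Cmod; cbn [fst snd].
  replace ((exp (Re z) * cos (Im z)) ^ 2 + (exp (Re z) * sin (Im z)) ^ 2)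
    with (Rsqr (exp (Re z))).
  - apply sqrt_Rsqr, Rlt_le, exp_pos.
  - assert (H := sin2_cos2 (Im z)); unfold Rsqr in *; nra.
Qed.

Lemma Cexp_plus (u v : C) : Cexp (u + v) = (Cexp u * Cexp v)%C.
Proof.
  destruct u as [a b], v as [c d].
  unfold Cexp, Cmult, Cplus, Re, Im; cbn [fst snd].
  rewrite exp_plus, cos_plus, sin_plus.
  apply injective_projections; cbn [fst snd]; ring.
Qed.

Lemma Cmod_le_sum (z : C) : Cmod z <= Rabs (Re z) + Rabs (Im z).
Proof.
  destruct z as [a b]; unfold Re, Im; cbn [fst snd].
  replace (a, b) with (RtoC a + (0, b))%C
    by (unfold RtoC, Cplus; cbn; f_equal; ring).
  eapply Rle_trans; [apply Cmod_triangle|].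
  rewrite Cmod_R; apply Rplus_le_compat_l.
  unfold Cmod; cbn [fst snd].
  replace (0 ^ 2 + b ^ 2) with (Rsqr b) by (unfold Rsqr; ring).
  rewrite sqrt_Rsqr_abs; lra.
Qed.

Lemma im_le_Cmod (z : C) : Rabs (Im z) <= Cmod z.
Proof.
  eapply Rle_trans; [|apply Rmax_Cmod]; apply Rmax_r.
Qed.

(** The function [(1 + z s) (1 - s)^z] is [1] at [s = 0], and its derivative
    [- z (1 + z) s (1 - s)^z / (1 - s)] vanishes there to first order; so the
    distance to [1] is quadratic in [s], uniformly for bounded [z].  With
    [s = 1/(n+1)] this is the quotient of consecutive terms of Gauss's sequence. *)
Lemma gauss_factor_bound (M : R) (hM : 0 <= M) :
  exists C0, 0 < C0 /\ forall (z : C) (s : R), Cmod z <= M -> 0 <= s <= / 2 ->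
    Cmod ((1 + z * RtoC s) * Cexp (z * RtoC (ln (1 - s))) - 1)%C <= C0 * s ^ 2.
Proof.
  set (D := 4 * (M * (1 + M)) * exp (M * ln 2)).
  assert (hD : 0 <= D).
  { unfold D; assert (H := exp_pos (M * ln 2)).
    apply Rmult_le_pos; [nra|lra]. }
  exists (4 * D + 1); split; [lra|].
  intros [p b] s hz hs.
  assert (hp : Rabs p <= M) by (eapply Rle_trans; [apply (re_le_Cmod (p, b))|exact hz]).
  assert (hb : Rabs b <= M) by (eapply Rle_trans; [apply (im_le_Cmod (p, b))|exact hz]).
  assert (hw : Rabs (p + p * p - b * b) <= 2 * (M * (1 + M)) /\
               Rabs (b + 2 * p * b) <= 2 * (M * (1 + M))).
  { apply Rabs_le_between in hp; apply Rabs_le_between in hb.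
    split; apply Rabs_le_between; split; nra. }
  assert (he : forall t, Rabs t <= / 2 -> exp (p * ln (1 - t)) <= exp (M * ln 2)).
  { intros t ht; apply Rabs_le_between in ht.
    assert (h1 : - ln 2 <= ln (1 - t) <= ln 2).
    { rewrite <- ln_Rinv by lra; split; apply ln_le; lra. }
    apply Rabs_le_between in hp.
    apply exp_le; nra. }
  (* the real and imaginary parts, and their derivatives *)
  set (f := fun t => exp (p * ln (1 - t)) *
     ((1 + p * t) * cos (b * ln (1 - t)) - b * t * sin (b * ln (1 - t)))).
  set (g := fun t => exp (p * ln (1 - t)) *
     ((1 + p * t) * sin (b * ln (1 - t)) + b * t * cos (b * ln (1 - t)))).
  set (df := fun t => - t / (1 - t) * exp (p * ln (1 - t)) *
     ((p + p * p - b * b) * cos (b * ln (1 - t)) - (b + 2 * p * b) * sin (b * ln (1 - t)))).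
  set (dg := fun t => - t / (1 - t) * exp (p * ln (1 - t)) *
     ((p + p * p - b * b) * sin (b * ln (1 - t)) + (b + 2 * p * b) * cos (b * ln (1 - t)))).
  assert (hf : forall t, t < 1 -> is_derive f t (df t)).
  { intros t ht; unfold f, df; auto_derive; [lra|].
    replace (1 + - t) with (1 - t) by ring; field; lra. }
  assert (hg : forall t, t < 1 -> is_derive g t (dg t)).
  { intros t ht; unfold g, dg; auto_derive; [lra|].
    replace (1 + - t) with (1 - t) by ring; field; lra. }
  assert (bound : forall t e u v c d W, Rabs t <= s ->
     0 < e <= exp (M * ln 2) -> Rabs u <= W -> Rabs v <= W ->
     Rabs c <= 1 -> Rabs d <= 1 ->
     Rabs (- t / (1 - t) * e * (u * c + v * d)) <= 4 * W * exp (M * ln 2) * s).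
  { intros t e u v c d W ht hte hu hv hc hd.
    assert (ht' := proj1 (Rabs_le_between _ _) ht).
    rewrite !Rabs_mult, (Rabs_right e) by lra.
    assert (h1 : Rabs (- t / (1 - t)) <= 2 * s).
    { unfold Rdiv; rewrite Rabs_mult, Rabs_Ropp.
      rewrite (Rabs_right (/ _)) by (apply Rle_ge, Rlt_le, Rinv_0_lt_compat; lra).
      rewrite Rmult_comm.
      apply Rmult_le_compat; try lra.
      - apply Rlt_le, Rinv_0_lt_compat; lra.
      - apply Rabs_pos.
      - rewrite <- (Rinv_inv 2); apply Rinv_le_contravar; lra. }
    assert (h2 : Rabs (u * c + v * d) <= 2 * W).
    { eapply Rle_trans; [apply Rabs_triang|]; rewrite !Rabs_mult.
      assert (H1 := Rabs_pos u); assert (H2 := Rabs_pos v).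
      assert (H3 := Rabs_pos c); assert (H4 := Rabs_pos d). nra. }
    replace (4 * W * exp (M * ln 2) * s) with ((2 * s) * exp (M * ln 2) * (2 * W)) by ring.
    apply Rmult_le_compat; try apply Rabs_pos; try lra.
    - apply Rmult_le_pos; [apply Rabs_pos|lra].
    - apply Rmult_le_compat; try apply Rabs_pos; lra. }
  assert (hcos : forall t, Rabs (cos t) <= 1)
    by (intros t; apply Rabs_le_between; split; apply COS_bound).
  assert (hsin : forall t, Rabs (sin t) <= 1)
    by (intros t; apply Rabs_le_between; split; apply SIN_bound).
  assert (in_seg : forall t, Rabs (t - 0) <= Rabs (s - 0) -> t < 1 /\ Rabs t <= s).
  { intros t; rewrite !Rminus_0_r, (Rabs_right s) by lra.
    intros h; split; [|exact h]. apply Rabs_le_between in h; lra. }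
  assert (vf : Rabs (f s - f 0) <= 2 * D * s * Rabs (s - 0)).
  { apply bounded_variation with df; intros t ht; apply in_seg in ht.
    destruct ht as [ht ht']; split; [now apply hf|].
    unfold df; replace (2 * D * s) with (4 * (2 * (M * (1 + M))) * exp (M * ln 2) * s)
      by (unfold D; ring).
    replace (_ * cos _ - _) with ((p + p * p - b * b) * cos (b * ln (1 - t))
      + (b + 2 * p * b) * - sin (b * ln (1 - t))) by ring.
    apply bound; try tauto; try rewrite Rabs_Ropp; auto.
    split; [apply exp_pos|apply he; lra]. }
  assert (vg : Rabs (g s - g 0) <= 2 * D * s * Rabs (s - 0)).
  { apply bounded_variation with dg; intros t ht; apply in_seg in ht.
    destruct ht as [ht ht']; split; [now apply hg|].
    unfold dg; replace (2 * D * s) with (4 * (2 * (M * (1 + M))) * exp (M * ln 2) * s)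
      by (unfold D; ring).
    apply bound; try tauto; auto.
    split; [apply exp_pos|apply he; lra]. }
  rewrite Rminus_0_r, (Rabs_right s) in vf, vg by lra.
  assert (f0 : f 0 = 1).
  { unfold f; rewrite Rminus_0_r, ln_1, !Rmult_0_r, exp_0, cos_0; ring. }
  assert (g0 : g 0 = 0).
  { unfold g; rewrite Rminus_0_r, ln_1, !Rmult_0_r, exp_0, sin_0; ring. }
  rewrite f0 in vf; rewrite g0 in vg.
  replace ((1 + (p, b) * s) * Cexp ((p, b) * RtoC (ln (1 - s))) - 1)%C
    with (f s - 1, g s - 0).
  - eapply Rle_trans; [apply Cmod_le_sum|]; unfold Re, Im; cbn [fst snd].
    nra.
  - unfold f, g, Cexp, Cminus, Copp, Cplus, Cmult, RtoC, Re, Im; cbn [fst snd].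
    rewrite !Rmult_0_r, !Rminus_0_r, !Rplus_0_l.
    apply injective_projections; cbn [fst snd]; ring.
Qed.

(** * Limits of slowly varying complex sequences *)

(** Stated on components because [rGamma] is defined through them. *)
Definition is_Clim (u : nat -> C) (l : C) : Prop :=
  is_lim_seq (fun n => Re (u n)) (Re l) /\ is_lim_seq (fun n => Im (u n)) (Im l).

Lemma is_Clim_unique (u : nat -> C) (l l' : C) :
  is_Clim u l -> is_Clim u l' -> l = l'.
Proof.
  intros [h1 h2] [h3 h4].
  apply is_lim_seq_unique in h1, h2, h3, h4.
  rewrite h1 in h3; rewrite h2 in h4; injection h3; injection h4; intros.
  now apply injective_projections.
Qed.

Lemma is_Clim_mult (u v : nat -> C) (l l' : C) :
  is_Clim u l -> is_Clim v l' -> is_Clim (fun n => u n * v n)%C (l * l')%C.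
Proof.
  intros [h1 h2] [h3 h4]; split; unfold Cmult, Re, Im in *; cbn [fst snd].
  - apply is_lim_seq_minus'; apply is_lim_seq_mult'; assumption.
  - apply is_lim_seq_plus'; apply is_lim_seq_mult'; assumption.
Qed.

Lemma is_Clim_ext_loc (u v : nat -> C) (l : C) :
  eventually (fun n => u n = v n) -> is_Clim u l -> is_Clim v l.
Proof.
  intros [N h] [h1 h2]; split; (eapply is_lim_seq_ext_loc;
    [exists N; intros n hn; rewrite <- (h n hn); reflexivity|]); assumption.
Qed.

Lemma is_Clim_const (c : C) : is_Clim (fun _ => c) c.
Proof. split; apply is_lim_seq_const. Qed.

Lemma is_Clim_Cmod (u : nat -> C) (l : C) :
  is_Clim u l -> is_lim_seq (fun n => Cmod (u n)) (Cmod l).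
Proof.
  intros [h1 h2]; unfold Cmod.
  apply (is_lim_seq_continuous sqrt (fun n => fst (u n) ^ 2 + snd (u n) ^ 2)).
  - apply continuity_pt_sqrt; nra.
  - cbn [pow]; rewrite !Rmult_1_r.
    apply is_lim_seq_ext with (fun n => Re (u n) * Re (u n) + Im (u n) * Im (u n)).
    + intros n; unfold Re, Im; ring.
    + apply is_lim_seq_plus'; apply is_lim_seq_mult'; assumption.
Qed.

Lemma is_Clim_plus (u v : nat -> C) (l l' : C) :
  is_Clim u l -> is_Clim v l' -> is_Clim (fun n => u n + v n)%C (l + l')%C.
Proof.
  intros [h1 h2] [h3 h4]; split; unfold Cplus, Re, Im in *; cbn [fst snd];
  apply is_lim_seq_plus'; assumption.
Qed.

Lemma is_Clim_minus (u v : nat -> C) (l l' : C) :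
  is_Clim u l -> is_Clim v l' -> is_Clim (fun n => u n - v n)%C (l - l')%C.
Proof.
  intros [h1 h2] [h3 h4]; split; unfold Cminus, Cplus, Copp, Re, Im in *; cbn [fst snd];
  apply is_lim_seq_minus'; assumption.
Qed.

(** Since [1/(n+1)^2 <= 1/n - 1/(n+1)], the increments telescope: as long as
    [|r n| <= 2 |r N|] the sequence has moved by at most
    [2 C0 |r N| (1/N - 1/n) <= |r N| / 2], which in turn keeps [|r n|] below
    [2 |r N|].  The explicit factors [1/2] and [2] make the bound on the limit
    uniform over any family of sequences that share [C0]. *)
Lemma slowly_varying_seq (r : nat -> C) (C0 : R) (N : nat) :
  0 < C0 -> 4 * C0 <= INR N ->
  (forall n, (N <= n)%nat ->
     Cmod (r (S n) - r n)%C <= C0 * (/ INR (S n)) ^ 2 * Cmod (r n)) ->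
  exists l : C, is_Clim r l /\ Cmod (r N) / 2 <= Cmod l <= 2 * Cmod (r N).
Proof.
  intros hC0 hN step.
  set (A := Cmod (r N)).
  assert (hA : 0 <= A) by apply Cmod_ge_0.
  assert (inv_step : forall n, (N <= n)%nat ->
     0 < / INR (S n) /\ (/ INR (S n)) ^ 2 <= / INR n - / INR (S n) /\ / INR n <= / INR N).
  { intros n hn; apply le_INR in hn; rewrite S_INR.
    assert (h0 : 0 < INR n) by lra.
    split; [apply Rinv_0_lt_compat; lra|split].
    - replace (/ INR n - / (INR n + 1)) with (/ INR n * / (INR n + 1)) by (field; lra).
      cbn [pow]; rewrite Rmult_1_r; apply Rmult_le_compat_r.
      + apply Rlt_le, Rinv_0_lt_compat; lra.
      + apply Rinv_le_contravar; lra.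
    - apply Rinv_le_contravar; lra. }
  assert (hNinv : C0 * / INR N <= / 4).
  { assert (h0 : 0 < INR N) by lra.
    apply Rmult_le_reg_r with (INR N); [exact h0|].
    rewrite Rmult_assoc, Rinv_l by lra; lra. }
  assert (tri : forall a b c : C, Cmod (a - c)%C <= Cmod (a - b)%C + Cmod (b - c)%C).
  { intros a b c; replace (a - c)%C with ((a - b) + (b - c))%C by ring.
    apply Cmod_triangle. }
  (* both bounds are needed together for the induction to close *)
  assert (base : forall k, Cmod (r (N + k)%nat - r N)%C
     <= 2 * C0 * A * (/ INR N - / INR (N + k)) /\ Cmod (r (N + k)%nat) <= 2 * A).
  { assert (up : forall n, (N <= n)%nat ->
       Cmod (r n - r N)%C <= 2 * C0 * A * (/ INR N - / INR n) -> Cmod (r n) <= 2 * A).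
    { intros n hn h.
      assert (h1 : Cmod (r n) <= Cmod (r n - r N)%C + A).
      { replace (r n) with ((r n - r N) + r N)%C at 1 by ring. apply Cmod_triangle. }
      assert (h2 : 0 < / INR n).
      { apply Rinv_0_lt_compat; apply le_INR in hn; lra. }
      assert (h4 : 0 <= C0 * / INR n) by nra. nra. }
    induction k as [|k IH].
    - rewrite Nat.add_0_r; split; [|fold A; lra].
      replace (r N - r N)%C with (RtoC 0) by ring. rewrite Cmod_0; lra.
    - destruct IH as [IH1 IH2].
      assert (hk : (N <= N + k)%nat) by lia.
      assert (h : Cmod (r (N + S k)%nat - r N)%C
        <= 2 * C0 * A * (/ INR N - / INR (N + S k))).
      { eapply Rle_trans; [apply tri with (b := r (N + k)%nat)|].
        rewrite Nat.add_succ_r.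
        assert (h1 := step _ hk); destruct (inv_step _ hk) as (h2 & h3 & h4).
        assert (h5 : C0 * (/ INR (S (N + k))) ^ 2 * Cmod (r (N + k)%nat)
           <= C0 * (/ INR (N + k) - / INR (S (N + k))) * (2 * A)).
        { apply Rmult_le_compat; try assumption.
          - apply Rmult_le_pos; [lra|apply pow2_ge_0].
          - apply Cmod_ge_0.
          - apply Rmult_le_compat_l; lra. }
        nra. }
      split; [exact h|]. apply up; [lia|exact h]. }
  assert (gen : forall n k, (N <= n)%nat ->
     Cmod (r (n + k)%nat - r n)%C <= 2 * C0 * A * (/ INR n - / INR (n + k))).
  { intros n k hn; induction k as [|k IH].
    - rewrite Nat.add_0_r. replace (r n - r n)%C with (RtoC 0) by ring.
      rewrite Cmod_0; lra.
    - eapply Rle_trans; [apply tri with (b := r (n + k)%nat)|].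
      rewrite Nat.add_succ_r.
      assert (hk : (N <= n + k)%nat) by lia.
      assert (h1 := step _ hk); destruct (inv_step _ hk) as (h2 & h3 & h4).
      assert (h6 : Cmod (r (n + k)%nat) <= 2 * A).
      { replace (n + k)%nat with (N + (n + k - N))%nat by lia. apply base. }
      assert (h5 : C0 * (/ INR (S (n + k))) ^ 2 * Cmod (r (n + k)%nat)
           <= C0 * (/ INR (n + k) - / INR (S (n + k))) * (2 * A)).
      { apply Rmult_le_compat; try assumption.
        - apply Rmult_le_pos; [lra|apply pow2_ge_0].
        - apply Cmod_ge_0.
        - apply Rmult_le_compat_l; lra. }
      nra. }
  assert (gen' : forall n m, (N <= n)%nat -> (n <= m)%nat ->
     Cmod (r m - r n)%C <= 2 * C0 * A * / INR n).
  { intros n m hn hm; replace m with (n + (m - n))%nat by lia.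
    eapply Rle_trans; [apply gen, hn|].
    apply Rmult_le_compat_l; [nra|].
    assert (h : 0 < / INR (n + (m - n))); [|lra].
    apply Rinv_0_lt_compat.
    assert (h := le_INR N (n + (m - n)) ltac:(lia)); lra. }
  assert (cauchy : forall eps : posreal, exists K, forall n m,
     (K <= n)%nat -> (K <= m)%nat -> Cmod (r n - r m)%C < eps).
  { intros eps.
    destruct (nfloor_ex (4 * C0 * A / eps)) as [K hK].
    { apply Rmult_le_pos; [nra|apply Rlt_le, Rinv_0_lt_compat, eps]. }
    exists (N + S K)%nat; intros n m hn hm.
    assert (h1 := gen' (N + S K)%nat n ltac:(lia) hn).
    assert (h2 := gen' (N + S K)%nat m ltac:(lia) hm).
    assert (h3 : 2 * C0 * A * / INR (N + S K) < eps / 2).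
    { assert (h0 : INR K + 1 <= INR (N + S K)).
      { rewrite plus_INR, S_INR; assert (h := pos_INR N); lra. }
      assert (hp := pos_INR K). assert (he := cond_pos eps).
      apply Rmult_lt_reg_r with (INR (N + S K)); [lra|].
      rewrite Rmult_assoc, Rinv_l by lra.
      assert (h4 : 4 * C0 * A < eps * INR (N + S K)).
      { replace (4 * C0 * A) with (eps * (4 * C0 * A / eps)) by (field; lra).
        apply Rmult_lt_compat_l; lra. }
      lra. }
    eapply Rle_lt_trans; [apply tri with (b := r (N + S K)%nat)|].
    rewrite <- (Cmod_opp (r (N + S K)%nat - r m)%C).
    replace (- (r (N + S K)%nat - r m))%C with (r m - r (N + S K)%nat)%C by ring.
    lra. }
  assert (cre : ex_finite_lim_seq (fun n => Re (r n))).
  { apply ex_lim_seq_cauchy_corr; intros eps; destruct (cauchy eps) as [K hK].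
    exists K; intros n m hn hm; eapply Rle_lt_trans; [|apply (hK n m hn hm)].
    apply (re_le_Cmod (r n - r m)%C). }
  assert (cim : ex_finite_lim_seq (fun n => Im (r n))).
  { apply ex_lim_seq_cauchy_corr; intros eps; destruct (cauchy eps) as [K hK].
    exists K; intros n m hn hm; eapply Rle_lt_trans; [|apply (hK n m hn hm)].
    apply (im_le_Cmod (r n - r m)%C). }
  destruct cre as [a ha], cim as [b hb].
  assert (hlim : is_Clim r (a, b)) by (split; assumption).
  exists (a, b); split; [exact hlim|].
  assert (hd : Cmod ((a, b) - r N)%C <= A / 2).
  { assert (h := is_Clim_Cmod _ _ (is_Clim_minus _ _ _ _ hlim (is_Clim_const (r N)))).
    assert (h' : Rbar_le (Cmod ((a, b) - r N)%C) (A / 2)); [|exact h'].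
    apply (is_lim_seq_le_loc (fun n => Cmod (r n - r N)%C) (fun _ => A / 2)).
    - exists N; intros n hn; eapply Rle_trans; [apply (gen' N n); lia|nra].
    - exact h.
    - apply is_lim_seq_const. }
  split.
  - assert (h : A <= Cmod ((a, b) - r N)%C + Cmod (a, b)); [|lra].
    rewrite <- (Cmod_opp ((a, b) - r N)%C). unfold A.
    replace (r N) with (- ((a, b) - r N) + (a, b))%C at 1 by ring.
    apply Cmod_triangle.
  - assert (h : Cmod (a, b) <= Cmod ((a, b) - r N)%C + A); [|lra].
    replace (a, b) with (((a, b) - r N) + r N)%C at 1 by ring.
    apply Cmod_triangle.
Qed.

(** * The reciprocal Gamma function *)

Lemma rGamma_seq_succ (z : C) (n : nat) : (1 <= n)%nat ->
  rGamma_seq z (S n) =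
  (rGamma_seq z n * ((1 + z * RtoC (/ INR (S n)))
     * Cexp (z * RtoC (ln (1 - / INR (S n))))))%C.
Proof.
  intros hn; apply le_INR in hn; cbn [INR] in hn.
  assert (hS : INR (S n) <> 0) by (rewrite S_INR; lra).
  assert (hf : INR (fact n) <> 0) by apply INR_fact_neq_0.
  assert (hl : ln (1 - / INR (S n)) = ln (INR n) - ln (INR (S n))).
  { replace (1 - / INR (S n)) with (INR n * / INR (S n))
      by (rewrite S_INR in *; field; lra).
    rewrite ln_mult, ln_Rinv; try lra; rewrite S_INR; try lra.
    apply Rinv_0_lt_compat; lra. }
  unfold rGamma_seq; rewrite hl, fact_simpl, mult_INR.
  replace (Cexp (- z * RtoC (ln (INR (S n)))))
    with (Cexp (- z * RtoC (ln (INR n))) * Cexp (z * RtoC (ln (INR n) - ln (INR (S n)))))%C.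
  - change (rising z (S (S n))) with (rising z (S n) * (z + RtoC (INR (S n))))%C.
    set (e1 := Cexp _); set (e2 := Cexp _); set (p := rising z (S n)).
    rewrite RtoC_mult, RtoC_inv by exact hS.
    assert (hS' : RtoC (INR (S n)) <> 0) by (intros h; apply hS; now injection h).
    assert (hf' : RtoC (INR (fact n)) <> 0) by (intros h; apply hf; now injection h).
    field; tauto.
  - rewrite <- Cexp_plus; f_equal; rewrite RtoC_minus; ring.
Qed.

(** One index [N] serves for the whole disc of radius [M]: the value of the
    entire function is controlled there by a finite product. *)
Lemma rGamma_seq_uniform (M : R) (hM : 0 <= M) :
  exists N : nat, (1 <= N)%nat /\ forall z : C, Cmod z <= M ->
    is_Clim (rGamma_seq z) (rGamma z) /\
    Cmod (rGamma_seq z N) / 2 <= Cmod (rGamma z) <= 2 * Cmod (rGamma_seq z N).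
Proof.
  destruct (gauss_factor_bound M hM) as (C0 & hC0 & hq).
  destruct (nfloor_ex (4 * C0)) as [K hK]; [lra|].
  exists (S K); split; [lia|].
  intros z hz.
  destruct (slowly_varying_seq (rGamma_seq z) C0 (S K)) as (l & hl & hb).
  - exact hC0.
  - rewrite S_INR; lra.
  - intros n hn.
    rewrite rGamma_seq_succ by lia.
    set (q := (_ * Cexp _)%C).
    replace (rGamma_seq z n * q - rGamma_seq z n)%C
      with ((q - 1) * rGamma_seq z n)%C by ring.
    rewrite Cmod_mult; apply Rmult_le_compat_r; [apply Cmod_ge_0|].
    apply hq; [exact hz|].
    assert (h := le_INR 2 (S n) ltac:(lia)); change (INR 2) with 2 in h.
    split; [apply Rlt_le, Rinv_0_lt_compat|apply Rinv_le_contravar]; lra.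
  - assert (e : rGamma z = l).
    { destruct hl as [h1 h2]; apply is_lim_seq_unique in h1, h2.
      unfold rGamma; rewrite h1, h2; now destruct l. }
    rewrite e; auto.
Qed.

Lemma is_Clim_rGamma (z : C) : is_Clim (rGamma_seq z) (rGamma z).
Proof.
  destruct (rGamma_seq_uniform (Cmod z) (Cmod_ge_0 z)) as (N & _ & h).
  apply h; lra.
Qed.

Lemma rising_shift (z : C) (n : nat) : rising z (S n) = (z * rising (z + 1) n)%C.
Proof.
  induction n as [|n IH].
  - cbn; ring.
  - change (rising z (S (S n))) with (rising z (S n) * (z + RtoC (INR (S n))))%C.
    rewrite IH; cbn [rising]; rewrite S_INR, RtoC_plus; ring.
Qed.

Lemma rGamma_seq_shift (z : C) (n : nat) : (1 <= n)%nat ->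
  (z * rGamma_seq (z + 1) n = rGamma_seq z n * (1 + (z + 1) * RtoC (/ INR n)))%C.
Proof.
  intros hn; apply le_INR in hn; cbn [INR] in hn.
  unfold rGamma_seq.
  assert (e : (z * rising (z + 1) (S n) = rising z (S n) * (z + RtoC (INR (S n))))%C)
    by (rewrite <- rising_shift; reflexivity).
  assert (e' : Cexp (- (z + 1) * RtoC (ln (INR n))) =
      (Cexp (- z * RtoC (ln (INR n))) * RtoC (/ INR n))%C).
  { replace (- (z + 1) * RtoC (ln (INR n)))%C
      with (- z * RtoC (ln (INR n)) + RtoC (- ln (INR n)))%C
      by (rewrite RtoC_opp; ring).
    rewrite Cexp_plus; f_equal; unfold Cexp, RtoC, Re, Im; cbn [fst snd].
    rewrite exp_Ropp, exp_ln, cos_0, sin_0 by lra; f_equal; ring. }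
  rewrite e'; set (e1 := Cexp _).
  replace (z * (rising (z + 1) (S n) / RtoC (INR (fact n)) * (e1 * RtoC (/ INR n))))%C
    with ((z * rising (z + 1) (S n)) / RtoC (INR (fact n)) * (e1 * RtoC (/ INR n)))%C
    by (unfold Cdiv; ring).
  rewrite e, S_INR, RtoC_plus, RtoC_inv by lra.
  assert (h0 : RtoC (INR n) <> 0) by (intros h; injection h; lra).
  assert (h1 : RtoC (INR (fact n)) <> 0) by (intros h; injection h; apply INR_fact_neq_0).
  field; tauto.
Qed.

Lemma rGamma_succ (z : C) : (z * rGamma (z + 1))%C = rGamma z.
Proof.
  apply is_Clim_unique with (fun n => rGamma_seq z n * (1 + (z + 1) * RtoC (/ INR n)))%C.
  - apply is_Clim_ext_loc with (fun n => z * rGamma_seq (z + 1) n)%C.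
    + exists 1%nat; intros n hn; now apply rGamma_seq_shift.
    + apply is_Clim_mult; [apply is_Clim_const|apply is_Clim_rGamma].
  - rewrite <- (Cmult_1_r (rGamma z)).
    apply is_Clim_mult; [apply is_Clim_rGamma|].
    assert (h0 : is_lim_seq (fun n => / INR n) 0).
    { apply (is_lim_seq_inv _ p_infty); [apply is_lim_seq_INR|discriminate]. }
    assert (e : RtoC 1 = (1 + (z + 1) * RtoC 0)%C) by ring.
    cut (is_Clim (fun n => 1 + (z + 1) * RtoC (/ INR n))%C (1 + (z + 1) * RtoC 0)%C);
      [now rewrite <- e|].
    assert (h : is_Clim (fun n => RtoC (/ INR n)) (RtoC 0)).
    { split; unfold RtoC, Re, Im; cbn [fst snd]; [exact h0|apply is_lim_seq_const]. }
    apply is_Clim_plus; [apply is_Clim_const|].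
    apply is_Clim_mult; [apply is_Clim_const|exact h].
Qed.

Lemma rGamma_rising (z : C) (n : nat) :
  rGamma z = (rising z n * rGamma (z + RtoC (INR n)))%C.
Proof.
  induction n as [|n IH].
  - cbn; replace (z + 0)%C with z by ring; ring.
  - rewrite IH, S_INR, RtoC_plus; cbn [rising].
    rewrite <- (rGamma_succ (z + RtoC (INR n))), Cplus_assoc; ring.
Qed.

Lemma Re_le_Cmod (z : C) : Re z <= Cmod z.
Proof. eapply Rle_trans; [apply Rle_abs|apply re_le_Cmod]. Qed.

(** The strip has width one, so that every half-line [g + l] can be brought
    into it by an integer translation; it starts at [2] so that the factors
    [z + k] have modulus at least [1] and [Re z - 1] is positive. *)
Lemma rGamma_strip (B : R) (hB : 0 <= B) :
  exists c, 0 < c /\ forall z : C, 2 <= Re z <= 3 -> Rabs (Im z) <= B ->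
    / c <= Cmod (rGamma z) <= c.
Proof.
  destruct (rGamma_seq_uniform (3 + B)) as (N & hN & h); [lra|].
  apply le_INR in hN; cbn [INR] in hN.
  assert (hf := INR_fact_lt_0 N).
  assert (hln : 0 <= ln (INR N)) by (rewrite <- ln_1; apply ln_le; lra).
  set (P := (3 + B + INR N) ^ S N).
  set (e := exp (3 * ln (INR N))).
  assert (he : 0 < e) by apply exp_pos.
  assert (he1 : 0 < / INR (fact N)) by now apply Rinv_0_lt_compat.
  assert (hP : 0 < P) by (apply pow_lt; lra).
  exists (2 * P + 2 * (INR (fact N) * e)).
  split; [nra|].
  intros z hz hz'.
  assert (hmod : Cmod z <= 3 + B).
  { eapply Rle_trans; [apply Cmod_le_sum|]. rewrite (Rabs_right (Re z)) by lra; lra. }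
  destruct (h z hmod) as [_ [h1 h2]].
  assert (hprod : forall n, (n <= S N)%nat -> 1 <= Cmod (rising z n) <= (3 + B + INR N) ^ n).
  { induction n as [|n IH]; intros hn.
    - cbn; rewrite Cmod_1; lra.
    - assert (hn' := le_INR n N ltac:(lia)); assert (hp := pos_INR n).
      cbn [rising pow]; rewrite Cmod_mult.
      destruct IH as [h3 h4]; [lia|].
      assert (h5 : 1 <= Cmod (z + RtoC (INR n))).
      { eapply Rle_trans; [|apply Re_le_Cmod]; unfold Cplus, RtoC, Re in *; cbn [fst snd]; lra. }
      assert (h6 : Cmod (z + RtoC (INR n)) <= 3 + B + INR N).
      { eapply Rle_trans; [apply Cmod_triangle|]. rewrite Cmod_R, Rabs_right by lra; lra. }
      split; [nra|]. rewrite Rmult_comm; apply Rmult_le_compat; try apply Cmod_ge_0; assumption. }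
  assert (hseq : Cmod (rGamma_seq z N)
    = Cmod (rising z (S N)) * / INR (fact N) * exp (- (Re z * ln (INR N)))).
  { unfold rGamma_seq, Cdiv; rewrite !Cmod_mult, Cmod_Cexp, <- RtoC_inv, Cmod_R by lra.
    rewrite Rabs_right by lra. do 2 f_equal.
    unfold Cmult, Copp, RtoC, Re, Im; cbn [fst snd]; ring. }
  destruct (hprod (S N) (le_n _)) as [h3 h4]; fold P in h4.
  assert (h5 : exp (- (Re z * ln (INR N))) <= 1).
  { rewrite <- exp_0; apply exp_le; nra. }
  assert (h6 : / e <= exp (- (Re z * ln (INR N)))).
  { unfold e; rewrite <- exp_Ropp; apply exp_le; nra. }
  assert (hfle : / INR (fact N) <= 1).
  { rewrite <- Rinv_1; apply Rinv_le_contravar; [lra|].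
    apply (le_INR 1), lt_O_fact. }
  assert (h7 := exp_pos (- (Re z * ln (INR N)))).
  rewrite hseq in h1, h2.
  set (x := exp (- (Re z * ln (INR N)))) in *.
  set (p := Cmod (rising z (S N))) in *.
  set (f := / INR (fact N)) in *.
  split.
  - apply Rle_trans with (f * / e / 2).
    + replace (f * / e / 2) with (/ (2 * (INR (fact N) * e)))
        by (unfold f; field; lra).
      apply Rinv_le_contravar; nra.
    + assert (hh : f * / e <= p * f * x); [|lra].
      apply Rmult_le_compat; try lra.
      * apply Rlt_le, Rinv_0_lt_compat, he.
      * nra.
  - assert (hh : p * f * x <= P).
    { assert (p * f <= P) by nra. assert (0 <= p * f) by nra. nra. }
    assert (0 < INR (fact N) * e) by nra. lra.
Qed.

(** * Stirling's formula up to subexponential factors *)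

(** The primitive of [ln]; [Phi 0 = 0] since [ln 0 = 0] here, which is also
    its limit at [0]. *)
Definition Phi (t : R) : R := t * ln t - t.

Lemma ln_le_sub1 (t : R) : 0 < t -> ln t <= t - 1.
Proof.
  intros ht; assert (h := exp_ineq1_le (ln t)); rewrite exp_ln in h; lra.
Qed.

Lemma ln_le_linear (k t : R) : 0 < k -> 0 < t -> ln t <= k * t - ln k.
Proof.
  intros hk ht; assert (h : 0 < k * t) by nra.
  apply ln_le_sub1 in h; rewrite ln_mult in h; lra.
Qed.

(** Convexity: the graph lies above its tangent at [s], whose slope is [ln s].
    Exchanging [s] and [t] gives the upper bound. *)
Lemma Phi_tangent (s t : R) : 0 < s -> 0 < t -> (t - s) * ln s <= Phi t - Phi s.
Proof.
  intros hs ht; unfold Phi.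
  assert (h : 0 < s / t) by (apply Rdiv_lt_0_compat; lra).
  apply ln_le_sub1 in h; unfold Rdiv in h.
  rewrite ln_mult, ln_Rinv in h by (try apply Rinv_0_lt_compat; lra).
  apply Rmult_le_compat_l with (r := t) in h; [|lra].
  replace (t * (s * / t - 1)) with (s - t) in h by (field; lra).
  lra.
Qed.

Lemma Phi_ge (t : R) : 0 < t -> -1 <= Phi t.
Proof.
  intros ht; assert (h := Phi_tangent 1 t Rlt_0_1 ht).
  unfold Phi in *; rewrite ln_1 in h; lra.
Qed.

(** A translation of the argument costs [O(ln l)], which is absorbed in
    [eps * l]. *)
Lemma Phi_shift (kappa eps : R) : 0 < eps ->
  exists K L, 1 <= L /\ 1 <= L + kappa /\ forall l, L <= l ->
    Rabs (Phi (l + kappa) - Phi l) <= eps * l + K.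
Proof.
  intros he.
  set (a := Rabs kappa + 1).
  assert (ha : 1 <= a /\ - (a - 1) <= kappa <= a - 1).
  { unfold a; assert (h := Rabs_pos kappa). split; [lra|].
    replace (Rabs kappa + 1 - 1) with (Rabs kappa) by ring.
    apply Rabs_le_between; lra. }
  assert (hk : 0 < eps / a) by (apply Rdiv_lt_0_compat; lra).
  exists (eps * a - a * ln (eps / a)), a; split; [lra|split; [lra|]].
  intros l hl.
  assert (h1 := Phi_tangent l (l + kappa) ltac:(lra) ltac:(lra)).
  assert (h2 := Phi_tangent (l + kappa) l ltac:(lra) ltac:(lra)).
  assert (h3 := ln_le_linear (eps / a) (l + a) hk ltac:(lra)).
  assert (h4 : 0 <= ln l <= ln (l + a)).
  { rewrite <- ln_1; split; apply ln_le; lra. }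
  assert (h5 : 0 <= ln (l + kappa) <= ln (l + a)).
  { rewrite <- ln_1; split; apply ln_le; lra. }
  assert (h6 : a * ln (l + a) <= eps * l + (eps * a - a * ln (eps / a))).
  { apply Rle_trans with (a * (eps / a * (l + a) - ln (eps / a))).
    - apply Rmult_le_compat_l; lra.
    - apply Req_le; field; lra. }
  apply Rabs_le_between; split; nra.
Qed.

(** Each factor satisfies [Re z + k <= |z + k| <= Re z + k + B], and by convexity
    [Phi (t) - Phi (t - 1) <= ln t <= Phi (t + 1) - Phi t]; both estimates
    telescope over [k < n]. *)
Lemma rising_bounds (z : C) (B : R) (n : nat) :
  2 <= Re z -> Rabs (Im z) <= B ->
  exp (Phi (Re z + INR n - 1) - Phi (Re z - 1)) <= Cmod (rising z n)
    <= exp (Phi (Re z + INR n + B) - Phi (Re z + B)).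
Proof.
  intros hz hB; assert (hB0 := Rabs_pos (Im z)).
  induction n as [|n IH].
  - cbn [INR rising]; rewrite Rplus_0_r, !Rminus_eq_0, exp_0, Cmod_1; lra.
  - assert (hn := pos_INR n).
    cbn [rising]; rewrite Cmod_mult, S_INR.
    assert (lo : Re z + INR n <= Cmod (z + RtoC (INR n))).
    { eapply Rle_trans; [|apply Re_le_Cmod].
      unfold Cplus, RtoC, Re in *; cbn [fst snd]; lra. }
    assert (up : Cmod (z + RtoC (INR n)) <= Re z + INR n + B).
    { eapply Rle_trans; [apply Cmod_le_sum|].
      unfold Cplus, RtoC, Re, Im in *; cbn [fst snd].
      rewrite Rplus_0_r, Rabs_right by lra; lra. }
    assert (t1 := Phi_tangent (Re z + INR n) (Re z + INR n - 1) ltac:(lra) ltac:(lra)).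
    assert (t2 := Phi_tangent (Re z + INR n + B) (Re z + (INR n + 1) + B)
      ltac:(lra) ltac:(lra)).
    destruct IH as [h1 h2]; split.
    + apply Rle_trans with (exp (Phi (Re z + INR n - 1) - Phi (Re z - 1))
        * exp (ln (Re z + INR n))).
      * rewrite <- exp_plus; apply exp_le.
        replace (Re z + (INR n + 1) - 1) with (Re z + INR n) by ring. lra.
      * apply Rmult_le_compat; try (apply Rlt_le, exp_pos); [exact h1|].
        rewrite exp_ln; lra.
    + apply Rle_trans with (exp (Phi (Re z + INR n + B) - Phi (Re z + B))
        * exp (ln (Re z + INR n + B))).
      * apply Rmult_le_compat; try apply Cmod_ge_0; [exact h2|].
        rewrite exp_ln; lra.
      * rewrite <- exp_plus; apply exp_le. lra.
Qed.

(** With [n] the integer that puts [z = g + l - n] into the strip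
    [2 <= Re z <= 3], [1/Gamma(z)] is the rising product of length [n] times
    [1/Gamma(g + l)]; the other two quantities have been estimated. *)
Lemma rGamma_stirling (g : C) (eps : R) : 0 < eps ->
  exists K L, 1 <= L /\ forall l, L <= l ->
    exp (- Phi l - eps * l - K) <= Cmod (rGamma (g + RtoC l)) <= exp (- Phi l + eps * l + K).
Proof.
  intros he.
  set (B := Rabs (Im g)).
  assert (hB : 0 <= B) by apply Rabs_pos.
  destruct (rGamma_strip B hB) as (c & hc & hstrip).
  destruct (Phi_shift (Re g - 1) eps he) as (K1 & L1 & hL1 & hL1' & sh1).
  destruct (Phi_shift (Re g + B) eps he) as (K2 & L2 & hL2 & hL2' & sh2).
  exists (ln c + 1 + Rabs K1 + Rabs K2), (L1 + L2 + Rabs (Re g) + 3).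
  assert (ha := Rabs_le_between (Re g) (Rabs (Re g))).
  apply proj1 in ha; specialize (ha (Rle_refl _)).
  split; [lra|].
  intros l hl.
  destruct (nfloor_ex (Re g + l - 2)) as [n hn]; [lra|].
  set (z := (g + RtoC (l - INR n))%C).
  assert (hre : Re z = Re g + l - INR n).
  { unfold z, Cplus, RtoC, Re; cbn [fst snd]; ring. }
  assert (him : Im z = Im g).
  { unfold z, Cplus, RtoC, Im; cbn [fst snd]; ring. }
  assert (hr := rGamma_rising z n).
  replace (z + RtoC (INR n))%C with (g + RtoC l)%C in hr
    by (unfold z; rewrite RtoC_minus; ring).
  assert (hs := hstrip z ltac:(rewrite hre; lra) ltac:(rewrite him; apply Rle_refl)).
  destruct (rising_bounds z B n) as [h1 h2];
    [rewrite hre; lra|rewrite him; apply Rle_refl|].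
  rewrite hr, Cmod_mult in hs.
  set (X := Cmod (rGamma (g + RtoC l))) in *.
  assert (hX : 0 <= X) by apply Cmod_ge_0.
  rewrite hre in h1, h2.
  replace (Re g + l - INR n + INR n - 1) with (l + (Re g - 1)) in h1 by ring.
  replace (Re g + l - INR n + INR n + B) with (l + (Re g + B)) in h2 by ring.
  assert (s1 := sh1 l ltac:(lra)); assert (s2 := sh2 l ltac:(lra)).
  apply Rabs_le_between in s1; apply Rabs_le_between in s2.
  assert (p1 : Phi (Re g + l - INR n - 1) <= 1).
  { set (t := Re g + l - INR n - 1).
    assert (ht : 1 <= t <= 2) by (unfold t; lra).
    assert (h := ln_le_sub1 t ltac:(lra)). unfold Phi; nra. }
  assert (p2 := Phi_ge (Re g + l - INR n + B) ltac:(lra)).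
  assert (k1 := Rle_abs K1); assert (k2 := Rle_abs K2).
  assert (k1' := Rabs_pos K1); assert (k2' := Rabs_pos K2).
  set (Y := Cmod (rising z n)) in *.
  set (e1 := Phi (l + (Re g - 1)) - Phi (Re g + l - INR n - 1)) in *.
  set (e2 := Phi (l + (Re g + B)) - Phi (Re g + l - INR n + B)) in *.
  assert (ec : c = exp (ln c)) by (rewrite exp_ln; lra).
  split.
  - apply Rmult_le_reg_l with (exp e2); [apply exp_pos|].
    apply Rle_trans with (Y * X); [|apply Rmult_le_compat_r; assumption].
    apply Rle_trans with (/ c); [|apply hs].
    rewrite <- exp_plus. rewrite ec at 2; rewrite <- exp_Ropp; apply exp_le.
    unfold e2; lra.
  - apply Rmult_le_reg_l with (exp e1); [apply exp_pos|].
    apply Rle_trans with (Y * X); [apply Rmult_le_compat_r; assumption|].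
    apply Rle_trans with c; [apply hs|].
    rewrite <- exp_plus. rewrite ec at 1; apply exp_le.
    unfold e1; lra.
Qed.

Lemma rising_neq_0 (z : C) (n : nat) : ~ nonpos_int z -> rising z n <> RtoC 0.
Proof.
  intros hz; induction n as [|n IH]; cbn [rising].
  - intros h; injection h; lra.
  - apply Cmult_neq_0; [exact IH|].
    intros h; apply hz; exists n.
    rewrite RtoC_opp; replace z with (z + RtoC (INR n) - RtoC (INR n))%C by ring.
    rewrite h; ring.
Qed.

Lemma rGamma_neq_0 (z : C) : ~ nonpos_int z -> rGamma z <> RtoC 0.
Proof.
  intros hz.
  destruct (rGamma_stirling z 1 Rlt_0_1) as (K & L & hL & h).
  destruct (nfloor_ex L) as [n hn]; [lra|].
  rewrite (rGamma_rising z (S n)); apply Cmult_neq_0; [now apply rising_neq_0|].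
  apply Cmod_gt_0. eapply Rlt_le_trans; [apply exp_pos|apply (h (INR (S n)))].
  rewrite S_INR; lra.
Qed.

(** * Pochhammer symbols and reciprocal Gamma values on lattices and rays *)

(** Replacing [g] by [g - c] moves the argument of [Phi] from [l] to [l + c].
    On a quadrant this makes the argument strictly positive on the boundary too,
    so that the indices [m = 0] and [n = 0] need no separate discussion. *)
Lemma rGamma_growth_shift (g : C) (c eps : R) : 0 <= c -> 0 < eps ->
  exists K L, 0 < L /\ forall l, L <= l ->
    exp (- Phi (l + c) - eps * l - K) <= Cmod (rGamma (g + RtoC l))
      <= exp (- Phi (l + c) + eps * l + K).
Proof.
  intros hc he.
  destruct (rGamma_stirling (g - RtoC c) eps he) as (K & L & hL & h).
  exists (K + eps * c), L; split; [lra|].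
  intros l hl; destruct (h (l + c)) as [h1 h2]; [lra|].
  replace (g - RtoC c + RtoC (l + c))%C with (g + RtoC l)%C in h1, h2
    by (rewrite RtoC_plus; ring).
  split; [eapply Rle_trans; [|exact h1]|eapply Rle_trans; [exact h2|]];
  apply exp_le; lra.
Qed.

(** The polynomial value of the symbol, used when [g] and [g + l] are both poles,
    concerns bounded [l] only. *)
Lemma poch_eq (g : C) (l : R) : ~ nonpos_int g \/ 0 < Re g + l ->
  poch g l = (rGamma g / rGamma (g + RtoC l))%C.
Proof.
  intros h; unfold poch; destruct excluded_middle_informative as [[h1 h2]|h1];
    [|reflexivity].
  exfalso; destruct h as [h|h]; [tauto|].
  destruct h2 as [k hk]; assert (hp := pos_INR k).
  apply (f_equal (fun z : C => Re z)) in hk.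
  unfold Cplus, RtoC, Re in *; cbn [fst snd] in *; lra.
Qed.

Lemma poch_growth_shift (g : C) (c eps : R) : 0 <= c -> 0 < eps ->
  exists K L, 0 < L /\ forall l, L <= l ->
    Cmod (rGamma g) * exp (Phi (l + c) - eps * l - K) <= Cmod (poch g l)
      <= Cmod (rGamma g) * exp (Phi (l + c) + eps * l + K).
Proof.
  intros hc he.
  destruct (rGamma_growth_shift g c eps hc he) as (K & L & hL & h).
  exists K, (L + Rabs (Re g)); assert (hg := Rabs_pos (Re g)); split; [lra|].
  intros l hl; destruct (h l) as [h1 h2]; [lra|].
  assert (hpos : 0 < Cmod (rGamma (g + RtoC l)))
    by (eapply Rlt_le_trans; [apply exp_pos|exact h1]).
  assert (hg' := Rle_abs (- Re g)); rewrite Rabs_Ropp in hg'.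
  rewrite poch_eq by (right; lra).
  rewrite Cmod_div by now apply Cmod_gt_0.
  unfold Rdiv; split; apply Rmult_le_compat_l; try apply Cmod_ge_0.
  - replace (Phi (l + c) - eps * l - K) with (- (- Phi (l + c) + eps * l + K)) by ring.
    rewrite exp_Ropp; now apply Rinv_le_contravar.
  - replace (Phi (l + c) + eps * l + K) with (- (- Phi (l + c) - eps * l - K)) by ring.
    rewrite exp_Ropp; apply Rinv_le_contravar; [apply exp_pos|exact h1].
Qed.

Lemma finite_bound (h : nat -> R) (M : nat) :
  exists K, forall m, (m <= M)%nat -> h m <= K.
Proof.
  induction M as [|M [K hK]].
  - exists (h 0%nat); intros m hm; replace m with 0%nat by lia; lra.
  - exists (Rmax K (h (S M))); intros m hm.
    destruct (le_lt_eq_dec _ _ hm) as [hm'|hm'].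
    + eapply Rle_trans; [apply hK; lia|apply Rmax_l].
    + rewrite hm'; apply Rmax_r.
Qed.

Lemma finite_bound2 (h : nat -> nat -> R) (M N : nat) :
  exists K, forall m n, (m <= M)%nat -> (n <= N)%nat -> h m n <= K.
Proof.
  induction M as [|M [K hK]].
  - destruct (finite_bound (h 0%nat) N) as [K hK].
    exists K; intros m n hm hn; replace m with 0%nat by lia; auto.
  - destruct (finite_bound (h (S M)) N) as [K' hK'].
    exists (Rmax K K'); intros m n hm hn.
    destruct (le_lt_eq_dec _ _ hm) as [hm'|hm'].
    + eapply Rle_trans; [apply hK; lia|apply Rmax_l].
    + rewrite hm'; eapply Rle_trans; [apply hK', hn|apply Rmax_r].
Qed.

(** The threshold [L] excludes finitely many lattice points only, and these are
    absorbed in the constant. *)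
Lemma lattice_bound (T P : R -> R) (a b K L : R) : 0 < a -> 0 < b -> 0 <= L ->
  (forall l, L <= l -> T l <= exp (P l + K)) ->
  exists K', forall m n : nat,
    T (a * INR m + b * INR n) <= exp (P (a * INR m + b * INR n) + K').
Proof.
  intros ha hb hL h.
  destruct (nfloor_ex (L / a)) as [M hM].
  { apply Rmult_le_pos; [lra|apply Rlt_le, Rinv_0_lt_compat, ha]. }
  destruct (nfloor_ex (L / b)) as [N hN].
  { apply Rmult_le_pos; [lra|apply Rlt_le, Rinv_0_lt_compat, hb]. }
  destruct (finite_bound2 (fun m n => T (a * INR m + b * INR n)
     * exp (- P (a * INR m + b * INR n))) M N) as [K' hK'].
  exists (Rmax K K'); intros m n.
  assert (hm := pos_INR m); assert (hn := pos_INR n).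
  assert (big : L <= a * INR m + b * INR n -> T (a * INR m + b * INR n)
     <= exp (P (a * INR m + b * INR n) + Rmax K K')).
  { intros hl; eapply Rle_trans; [apply h, hl|].
    apply exp_le, Rplus_le_compat_l, Rmax_l. }
  destruct (le_lt_dec m M) as [h1|h1]; [destruct (le_lt_dec n N) as [h2|h2]|].
  - set (l := a * INR m + b * INR n).
    assert (h3 := hK' m n h1 h2); cbn in h3; fold l in h3.
    rewrite exp_Ropp in h3.
    rewrite exp_plus.
    assert (hP := exp_pos (P l)).
    replace (T l) with (exp (P l) * (T l * / exp (P l))) by (field; lra).
    apply Rmult_le_compat_l; [lra|].
    apply Rle_trans with K'; [exact h3|].
    assert (h4 := exp_ineq1_le (Rmax K K')); assert (h5 := Rmax_r K K'); lra.
  - apply big.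
    apply (le_INR (S N)) in h2; rewrite S_INR in h2.
    assert (h3 : L <= b * INR n); [|nra].
    replace L with (b * (L / b)) by (field; lra).
    apply Rmult_le_compat_l; lra.
  - apply big.
    apply (le_INR (S M)) in h1; rewrite S_INR in h1.
    assert (h3 : L <= a * INR m); [|nra].
    replace L with (a * (L / a)) by (field; lra).
    apply Rmult_le_compat_l; lra.
Qed.

Lemma lattice_eps (a b eps : R) (m n : nat) : 0 < a -> 0 < b -> 0 < eps ->
  eps / (a + b) * (a * INR m + b * INR n) <= eps * (INR m + INR n).
Proof.
  intros ha hb he.
  replace (eps * (INR m + INR n)) with (eps / (a + b) * ((a + b) * (INR m + INR n)))
    by (field; lra).
  assert (hm := pos_INR m); assert (hn := pos_INR n).
  apply Rmult_le_compat_l; [|nra].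
  apply Rlt_le, Rdiv_lt_0_compat; lra.
Qed.

Lemma rGamma_lattice (g : C) (a b c eps : R) :
  0 < a -> 0 < b -> 0 <= c -> 0 < eps ->
  exists K, forall m n : nat, Cmod (rGamma (g + RtoC (a * INR m + b * INR n)))
    <= exp (- Phi (a * INR m + b * INR n + c) + eps * (INR m + INR n) + K).
Proof.
  intros ha hb hc he.
  assert (he' : 0 < eps / (a + b)) by (apply Rdiv_lt_0_compat; lra).
  destruct (rGamma_growth_shift g c _ hc he') as (K & L & hL & h).
  destruct (lattice_bound (fun l => Cmod (rGamma (g + RtoC l)))
    (fun l => - Phi (l + c) + eps / (a + b) * l) a b K L ha hb ltac:(lra)) as [K' hK'].
  { intros l hl; now apply h. }
  exists K'; intros m n; eapply Rle_trans; [apply hK'|].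
  apply exp_le; assert (hl := lattice_eps a b eps m n ha hb he); lra.
Qed.

Lemma poch_lattice (g : C) (a b c eps : R) :
  0 < a -> 0 < b -> 0 <= c -> 0 < eps ->
  exists K, forall m n : nat, Cmod (poch g (a * INR m + b * INR n))
    <= exp (Phi (a * INR m + b * INR n + c) + eps * (INR m + INR n) + K).
Proof.
  intros ha hb hc he.
  assert (he' : 0 < eps / (a + b)) by (apply Rdiv_lt_0_compat; lra).
  destruct (poch_growth_shift g c _ hc he') as (K & L & hL & h).
  destruct (lattice_bound (fun l => Cmod (poch g l))
    (fun l => Phi (l + c) + eps / (a + b) * l) a b (K + Cmod (rGamma g)) L ha hb
    ltac:(lra)) as [K' hK'].
  { intros l hl; eapply Rle_trans; [now apply h|].
    rewrite <- Rplus_assoc, (exp_plus _ (Cmod (rGamma g))), Rmult_comm.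
    apply Rmult_le_compat_l; [apply Rlt_le, exp_pos|].
    assert (h1 := exp_ineq1_le (Cmod (rGamma g))); lra. }
  exists K'; intros m n; eapply Rle_trans; [apply hK'|].
  apply exp_le; assert (hl := lattice_eps a b eps m n ha hb he); lra.
Qed.

(** For [c = 0] the right side is the fixed number [|1/Gamma(g)|], which has to be
    nonzero. *)
Lemma rGamma_ray_lower (g : C) (c eps : R) :
  0 <= c -> (c = 0 -> ~ nonpos_int g) -> 0 < eps ->
  exists K, eventually (fun k =>
    exp (- Phi (c * INR k) - eps * INR k - K) <= Cmod (rGamma (g + RtoC (c * INR k)))).
Proof.
  intros hc hg he; destruct (Req_dec c 0) as [h0|h0].
  - exists (- ln (Cmod (rGamma g))), 0%nat; intros k _.
    rewrite h0, Rmult_0_l, Cplus_0_r.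
    assert (h := proj1 (Cmod_gt_0 _) (rGamma_neq_0 g (hg h0))).
    rewrite <- (exp_ln _ h) at 2; apply exp_le.
    unfold Phi; assert (hk := pos_INR k); nra.
  - assert (hc' : 0 < c) by lra.
    destruct (rGamma_growth_shift g 0 (eps / c)) as (K & L & hL & h);
      [lra|apply Rdiv_lt_0_compat; lra|].
    destruct (nfloor_ex (L / c)) as [N hN].
    { apply Rlt_le, Rdiv_lt_0_compat; lra. }
    exists K, (S N); intros k hk; apply le_INR in hk; rewrite S_INR in hk.
    assert (hl : L <= c * INR k).
    { replace L with (c * (L / c)) by (field; lra). apply Rmult_le_compat_l; lra. }
    eapply Rle_trans; [|apply (h _ hl)].
    apply exp_le; rewrite Rplus_0_r; apply Req_le; field; lra.
Qed.

Lemma poch_ray_lower (g : C) (c eps : R) :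
  0 <= c -> ~ nonpos_int g -> 0 < eps ->
  exists K, eventually (fun k =>
    exp (Phi (c * INR k) - eps * INR k - K) <= Cmod (poch g (c * INR k))).
Proof.
  intros hc hg he.
  assert (hr := proj1 (Cmod_gt_0 _) (rGamma_neq_0 g hg)).
  destruct (Req_dec c 0) as [h0|h0].
  - exists 0, 0%nat; intros k _.
    rewrite h0, Rmult_0_l, poch_eq, Cplus_0_r by now left.
    rewrite Cmod_div by now apply Cmod_gt_0.
    rewrite Rdiv_diag, <- exp_0 by lra; apply exp_le.
    unfold Phi; assert (hk := pos_INR k); nra.
  - assert (hc' : 0 < c) by lra.
    destruct (poch_growth_shift g 0 (eps / c)) as (K & L & hL & h);
      [lra|apply Rdiv_lt_0_compat; lra|].
    destruct (nfloor_ex (L / c)) as [N hN].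
    { apply Rlt_le, Rdiv_lt_0_compat; lra. }
    exists (K - ln (Cmod (rGamma g))), (S N); intros k hk;
      apply le_INR in hk; rewrite S_INR in hk.
    assert (hl : L <= c * INR k).
    { replace L with (c * (L / c)) by (field; lra). apply Rmult_le_compat_l; lra. }
    eapply Rle_trans; [|apply (h _ hl)].
    rewrite <- (exp_ln _ hr) at 2; rewrite <- exp_plus.
    apply exp_le; rewrite Rplus_0_r; apply Req_le; field; lra.
Qed.

(** * The exponential rate of the terms *)

(** The sum of the [Phi]'s of the six Gamma factors of the general term at
    [(mu, nu)]. *)
Definition growth_exponent (a1 a2 a3 a4 b1 b2 b3 b4 mu nu : R) : R :=
  Phi (a1 * mu + b1 * nu) + Phi (a2 * mu) + Phi (b2 * nu)
  - Phi (a3 * mu + b3 * nu) - Phi (a4 * mu) - Phi (b4 * nu).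

Lemma E_pos (a1 a2 a3 a4 b1 b3 mu nu : R) : 0 < E a1 a2 a3 a4 b1 b3 mu nu.
Proof.
  unfold E, Rpower; apply Rmult_lt_0_compat; [apply exp_pos|].
  apply Rdiv_lt_0_compat; apply Rmult_lt_0_compat; apply exp_pos.
Qed.

Lemma ln_E (a1 a2 a3 a4 b1 b3 mu nu : R) :
  ln (E a1 a2 a3 a4 b1 b3 mu nu) =
  (a4 - a2) * ln mu + a3 * ln (a3 * mu + b3 * nu) + a4 * ln a4
  - a1 * ln (a1 * mu + b1 * nu) - a2 * ln a2.
Proof.
  unfold E, Rpower, Rdiv.
  rewrite <- !exp_plus, <- exp_Ropp, <- !exp_plus, ln_exp; ring.
Qed.

(** By this symmetry one analysis of [E] serves for both variables. *)
Lemma E'_swap (a1 a3 b1 b2 b3 b4 mu nu : R) :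
  E' a1 a3 b1 b2 b3 b4 mu nu = E b1 b2 b3 b4 a1 a3 nu mu.
Proof.
  unfold E, E'; now rewrite (Rplus_comm (a3 * mu)), (Rplus_comm (a1 * mu)).
Qed.

(** In [Phi (a1 mu + b1 nu)] the factor in front of the logarithm is split into
    its [mu] part and its [nu] part; collecting them gives the logarithms of [E]
    and [E'].  The linear parts of the [Phi]'s leave [Delta mu + Delta' nu]. *)
Lemma growth_exponent_eq (a1 a2 a3 a4 b1 b2 b3 b4 mu nu : R) :
  0 < a2 -> 0 < a4 -> 0 < b2 -> 0 < b4 -> 0 < mu -> 0 < nu ->
  growth_exponent a1 a2 a3 a4 b1 b2 b3 b4 mu nu =
  mu * (a3 + a4 - a1 - a2 - ln (E a1 a2 a3 a4 b1 b3 mu nu))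
  + nu * (b3 + b4 - b1 - b2 - ln (E b1 b2 b3 b4 a1 a3 nu mu)).
Proof.
  intros; rewrite !ln_E; unfold growth_exponent, Phi.
  rewrite !ln_mult by assumption.
  rewrite (Rplus_comm (b3 * nu)), (Rplus_comm (b1 * nu)); ring.
Qed.

(** The contribution of one variable, at modulus [X], to the logarithm of the
    general term: it decreases linearly in its own index, at the price of an
    arbitrarily small multiple of the other index.  The rate [eta] is chosen
    before [eps], so that two such bounds can be added. *)
Definition tame (a1 a2 a3 a4 b1 b3 X : R) : Prop :=
  exists eta, 0 < eta /\ forall eps, 0 < eps -> exists K, forall mu nu, 0 < mu -> 0 < nu ->
    mu * (a3 + a4 - a1 - a2 - ln (E a1 a2 a3 a4 b1 b3 mu nu) + ln X)
      <= - eta * mu + eps * nu + K.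

Lemma tame_of_lt (a1 a2 a3 a4 b1 b3 X eta : R) :
  a3 + a4 - a1 - a2 = 0 -> 0 < eta ->
  (forall mu nu, 0 < mu -> 0 < nu -> ln X + eta <= ln (E a1 a2 a3 a4 b1 b3 mu nu)) ->
  tame a1 a2 a3 a4 b1 b3 X.
Proof.
  intros h0 heta h; exists eta; split; [exact heta|]; intros eps he; exists 0.
  intros mu nu hmu hnu; assert (h1 := h mu nu hmu hnu); rewrite h0.
  assert (0 < eps * nu) by nra; nra.
Qed.

(** With [t = nu / mu], [ln E = Delta ln mu + a3 ln (a3 + b3 t) - a1 ln (a1 + b1 t)]
    up to a constant.  The first logarithm is bounded below, the second is at most
    [eps t + C], and [mu * t = nu]; the term [- Delta mu ln mu] then dominates
    everything linear in [mu]. *)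
Lemma tame_of_pos (a1 a2 a3 a4 b1 b3 X : R) :
  0 < a1 -> 0 < a3 -> 0 < b1 -> 0 < b3 -> 0 < a3 + a4 - a1 - a2 ->
  tame a1 a2 a3 a4 b1 b3 X.
Proof.
  intros ha1 ha3 hb1 hb3 hD; set (D := a3 + a4 - a1 - a2) in *.
  exists 1; split; [lra|]; intros eps he.
  (* slope for which the linear bound on [a1 ln (a1 + b1 t)] has slope [eps] *)
  set (k := eps / (a1 * b1)).
  assert (hab : 0 < a1 * b1) by nra.
  assert (hk : 0 < k) by (apply Rdiv_lt_0_compat; assumption).
  set (Q := D - a3 * ln a3 - a4 * ln a4 + a2 * ln a2 + a1 * (k * a1 - ln k) + ln X).
  (* the tangent of [Phi] at [exp T] turns [- D mu ln mu + Q mu] into [- mu] + constant *)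
  set (T := (Q + 1) / D - 1).
  exists (D * exp T).
  intros mu nu hmu hnu; set (t := nu / mu).
  assert (ht : 0 < t) by (apply Rdiv_lt_0_compat; assumption).
  assert (eA : ln (a1 * mu + b1 * nu) = ln mu + ln (a1 + b1 * t)).
  { rewrite <- ln_mult by nra; f_equal; unfold t; field; lra. }
  assert (eB : ln (a3 * mu + b3 * nu) = ln mu + ln (a3 + b3 * t)).
  { rewrite <- ln_mult by nra; f_equal; unfold t; field; lra. }
  assert (hA : a1 * ln (a1 + b1 * t) <= a1 * (k * a1 - ln k) + eps * t).
  { apply Rle_trans with (a1 * (k * (a1 + b1 * t) - ln k)).
    - apply Rmult_le_compat_l; [lra|]; apply ln_le_linear; nra.
    - apply Req_le; unfold k; field; lra. }
  assert (hB : a3 * ln a3 <= a3 * ln (a3 + b3 * t)).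
  { apply Rmult_le_compat_l; [lra|]; apply ln_le; nra. }
  assert (hPhi := Phi_tangent (exp T) mu (exp_pos T) hmu).
  unfold Phi in hPhi; rewrite ln_exp in hPhi.
  assert (hl : mu * (1 + T) - exp T <= mu * ln mu) by lra.
  assert (et : mu * t = nu) by (unfold t; field; lra).
  rewrite ln_E, eA, eB.
  apply Rle_trans with (mu * (Q - D * ln mu + eps * t)).
  - apply Rmult_le_compat_l; [lra|]; unfold Q, D; lra.
  - replace (mu * (Q - D * ln mu + eps * t))
      with (mu * Q - D * (mu * ln mu) + eps * (mu * t)) by ring.
    rewrite et.
    apply Rmult_le_compat_l with (r := D) in hl; [|lra].
    assert (e : D * (1 + T) = Q + 1) by (unfold T; field; lra).
    assert (e2 : D * (mu * (1 + T) - exp T) = mu * (D * (1 + T)) - D * exp T) by ring.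
    rewrite e2, e in hl; lra.
Qed.

(** The infimum is taken over a nonempty set of reals, so it is finite or [-oo];
    any [X] strictly between [|x|] and it leaves a gap, uniform in [mu, nu]. *)
Lemma radius_gap (F : R -> R -> R) (x : C) :
  (forall mu nu, 0 < F mu nu) -> Rbar_lt (Cmod x) (inf_pos_quadrant F) ->
  exists X eta, 0 < X /\ Cmod x <= X /\ 0 < eta /\
    forall mu nu, 0 < mu -> 0 < nu -> ln X + eta <= ln (F mu nu).
Proof.
  intros hF hx.
  destruct (Glb_Rbar_correct
    (fun r => exists mu nu : R, 0 < mu /\ 0 < nu /\ r = F mu nu)) as [hlb _].
  fold (inf_pos_quadrant F) in hlb.
  assert (h : forall mu nu, 0 < mu -> 0 < nu -> Rbar_le (inf_pos_quadrant F) (F mu nu)).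
  { intros mu nu hmu hnu; apply hlb; now exists mu, nu. }
  assert (hc := Cmod_ge_0 x).
  destruct (inf_pos_quadrant F) as [r| |].
  - cbn in hx.
    exists ((Cmod x + r) / 2), (ln r - ln ((Cmod x + r) / 2)).
    split; [lra|split; [lra|split]].
    + assert (ln ((Cmod x + r) / 2) < ln r); [apply ln_increasing; lra|lra].
    + intros mu nu hmu hnu.
      replace (_ + _) with (ln r) by ring.
      apply ln_le; [lra|]; exact (h mu nu hmu hnu).
  - exfalso; exact (h 1 1 Rlt_0_1 Rlt_0_1).
  - exfalso; exact hx.
Qed.

(** * Double series *)

Lemma sum_n_geom_le (r : R) (N : nat) : 0 <= r < 1 -> sum_n (fun k => r ^ k) N <= / (1 - r).
Proof.
  intros hr.
  assert (h : sum_n (fun k => r ^ k) N = / (1 - r) - r ^ S N * / (1 - r)).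
  { induction N as [|N IH].
    - rewrite sum_O; cbn; field; lra.
    - rewrite sum_Sn, IH; unfold plus; cbn; field; lra. }
  rewrite h; assert (0 <= r ^ S N * / (1 - r)); [|lra].
  apply Rmult_le_pos; [apply pow_le; lra|apply Rlt_le, Rinv_0_lt_compat; lra].
Qed.

Lemma minus_plus_l {G : AbelianGroup} (a b : G) : minus (plus a b) a = b.
Proof.
  unfold minus; rewrite (plus_comm a b), <- plus_assoc.
  exact (eq_trans (f_equal (plus b) (plus_opp_r a)) (plus_zero_r b)).
Qed.

Lemma norm_minus_triangle {K : AbsRing} {V : NormedModule K}
  (a b c : V) :
  norm (minus a c) <= norm (minus a b) + norm (minus b c).
Proof.
  replace (minus a c) with (plus (minus a b) (minus b c)).
  - apply norm_triangle.
  - symmetry; apply minus_trans.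
Qed.

Lemma norm_minus_sym {K : AbsRing} {V : NormedModule K}
  (a b : V) : norm (minus a b) = norm (minus b a).
Proof. rewrite <- norm_opp; f_equal; apply opp_minus. Qed.

Lemma norm_geom_sum_le {K : AbsRing} {V : NormedModule K}
  (u : nat -> V) (B r : R) (N : nat) :
  0 <= B -> 0 <= r < 1 -> (forall k, norm (u k) <= B * r ^ k) ->
  norm (sum_n u N) <= B / (1 - r).
Proof.
  intros hB hr hu; unfold sum_n.
  eapply Rle_trans; [apply norm_sum_n_m|].
  eapply Rle_trans; [apply sum_n_m_le, hu|].
  fold (sum_n (fun k => B * r ^ k) N).
  assert (h : sum_n (fun k => B * r ^ k) N = B * sum_n (fun k => r ^ k) N)
    by exact (sum_n_mult_l (K := R_Ring) B (fun k => r ^ k) N).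
  rewrite h.
  apply Rmult_le_compat_l; [exact hB|].
  now apply sum_n_geom_le.
Qed.

Lemma geom_steps {K : AbsRing} {V : NormedModule K}
  (u : nat -> V) (B r : R) (n k : nat) :
  0 <= B -> 0 <= r < 1 ->
  (forall j, norm (minus (u (S j)) (u j)) <= B * r ^ j) ->
  norm (minus (u (n + k)%nat) (u n)) <= B / (1 - r) * r ^ n.
Proof.
  intros hB hr hu.
  assert (h : norm (minus (u (n + k)%nat) (u n)) <= B / (1 - r) * (r ^ n - r ^ (n + k))).
  { induction k as [|k IH].
    - rewrite Nat.add_0_r.
      assert (e : norm (minus (u n) (u n)) = 0)
        by (rewrite minus_eq_zero; apply (norm_zero (V := V))).
      rewrite e; lra.
    - rewrite Nat.add_succ_r.
      eapply Rle_trans; [apply norm_minus_triangle with (b := u (n + k)%nat)|].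
      eapply Rle_trans; [apply Rplus_le_compat; [apply hu|exact IH]|].
      apply Req_le; cbn [pow]; field; lra. }
  eapply Rle_trans; [exact h|].
  apply Rmult_le_compat_l.
  - apply Rmult_le_pos; [exact hB|apply Rlt_le, Rinv_0_lt_compat; lra].
  - assert (0 <= r ^ (n + k)) by (apply pow_le; lra); lra.
Qed.

Definition rect_sum {K : AbsRing} {V : NormedModule K} (a : nat -> nat -> V) (M N : nat) : V :=
  sum_n (fun m => sum_n (a m) N) M.

Lemma rect_sum_row {K : AbsRing} {V : NormedModule K}
  (a : nat -> nat -> V) (M N : nat) :
  minus (rect_sum a (S M) N) (rect_sum a M N) = sum_n (a (S M)) N.
Proof.
  unfold rect_sum; rewrite sum_Sn.
  exact (minus_plus_l (G := NormedModule.AbelianGroup K V) _ _).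
Qed.

Lemma rect_sum_col {K : AbsRing} {V : NormedModule K}
  (a : nat -> nat -> V) (M N : nat) :
  minus (rect_sum a M (S N)) (rect_sum a M N) = sum_n (fun m => a m (S N)) M.
Proof.
  unfold rect_sum.
  rewrite (sum_n_ext (fun m => sum_n (a m) (S N))
    (fun m => plus (sum_n (a m) N) (a m (S N))))
    by (intros m; apply sum_Sn).
  rewrite sum_n_plus.
  exact (minus_plus_l (G := NormedModule.AbelianGroup K V) _ _).
Qed.

(** A row or column is the difference of two neighbouring rectangular sums.  The
    index of the row and the length of the summation must both be large: single
    rows of a convergent double series need not converge. *)
Lemma double_series_tails {K : AbsRing} {V : NormedModule K}
  (a : nat -> nat -> V) : ex_double_series a ->
  forall eps, 0 < eps -> exists N0, forall m n, (N0 <= m)%nat -> (N0 <= n)%nat ->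
    norm (sum_n (a m) n) < eps /\ norm (sum_n (fun i => a i n) m) < eps.
Proof.
  intros [s hs] eps he.
  assert (he2 : 0 < eps / 2) by lra.
  assert (h := proj1 (filterlim_locally_ball_norm _ _) hs (mkposreal _ he2)).
  destruct h as [P Q [N1 h1] [N2 h2] h]; cbn [fst snd] in h.
  exists (S (N1 + N2)); intros m n hm hn.
  destruct m as [|m]; [lia|]; destruct n as [|n]; [lia|].
  assert (h3 := h (S m) (S n) (h1 (S m) ltac:(lia)) (h2 (S n) ltac:(lia))).
  assert (h4 := h m (S n) (h1 m ltac:(lia)) (h2 (S n) ltac:(lia))).
  assert (h5 := h (S m) n (h1 (S m) ltac:(lia)) (h2 n ltac:(lia))).
  unfold ball_norm in h3, h4, h5; cbn [pos] in h3, h4, h5.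
  rewrite <- rect_sum_row, <- rect_sum_col.
  fold (rect_sum a (S m) (S n)) in h3; fold (rect_sum a m (S n)) in h4;
  fold (rect_sum a (S m) n) in h5.
  replace eps with (eps / 2 + eps / 2) by field.
  split; (eapply Rle_lt_trans; [apply norm_minus_triangle with (b := s)|]);
  (apply Rplus_lt_compat; [exact h3|rewrite norm_minus_sym; assumption]).
Qed.

(** Beyond the corner [(n, n)] a rectangular sum changes by [O(r^n)]: first the
    number of rows is enlarged, then the number of columns. *)
Lemma ex_double_series_geom {K : AbsRing} {V : CompleteNormedModule K}
  (a : nat -> nat -> V) (B r : R) :
  0 <= B -> 0 < r < 1 -> (forall m n, norm (a m n) <= B * r ^ m * r ^ n) ->
  ex_double_series a.
Proof.
  intros hB hr ha.
  set (D := B / (1 - r)).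
  assert (hi : 0 < / (1 - r)) by (apply Rinv_0_lt_compat; lra).
  assert (hD : 0 <= D) by (apply Rmult_le_pos; lra).
  assert (hp : forall n, 0 <= r ^ n) by (intros n; apply pow_le; lra).
  assert (rstep : forall M N, norm (minus (rect_sum a (S M) N) (rect_sum a M N)) <= D * r ^ M).
  { intros M N; rewrite rect_sum_row.
    eapply Rle_trans; [apply norm_geom_sum_le with (B := B * r ^ S M) (r := r)|].
    - apply Rmult_le_pos; auto.
    - lra.
    - intros k; apply ha.
    - unfold D, Rdiv; cbn [pow].
      replace (B * (r * r ^ M) * / (1 - r)) with (r * (B * / (1 - r) * r ^ M)) by ring.
      assert (0 <= B * / (1 - r) * r ^ M) by (apply Rmult_le_pos; auto). nra. }
  assert (cstep : forall M N, norm (minus (rect_sum a M (S N)) (rect_sum a M N)) <= D * r ^ N).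
  { intros M N; rewrite rect_sum_col.
    eapply Rle_trans; [apply norm_geom_sum_le with (B := B * r ^ S N) (r := r)|].
    - apply Rmult_le_pos; auto.
    - lra.
    - intros k; eapply Rle_trans; [apply ha|]; apply Req_le; ring.
    - unfold D, Rdiv; cbn [pow].
      replace (B * (r * r ^ N) * / (1 - r)) with (r * (B * / (1 - r) * r ^ N)) by ring.
      assert (0 <= B * / (1 - r) * r ^ N) by (apply Rmult_le_pos; auto). nra. }
  set (G := D / (1 - r)).
  assert (hG : 0 <= G) by (apply Rmult_le_pos; lra).
  assert (corner : forall n M N, (n <= M)%nat -> (n <= N)%nat ->
    norm (minus (rect_sum a M N) (rect_sum a n n)) <= 2 * G * r ^ n).
  { intros n M N hM hN.
    eapply Rle_trans; [apply norm_minus_triangle with (b := rect_sum a n N)|].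
    assert (h1 := geom_steps (fun i => rect_sum a i N) D r n (M - n) hD ltac:(lra)
      (fun j => rstep j N)).
    assert (h2 := geom_steps (fun i => rect_sum a n i) D r n (N - n) hD ltac:(lra)
      (fun j => cstep n j)).
    cbn beta in h1, h2.
    replace (n + (M - n))%nat with M in h1 by lia.
    replace (n + (N - n))%nat with N in h2 by lia.
    fold G in h1, h2; lra. }
  apply (filterlim_locally_cauchy (U := CompleteNormedModule.CompleteSpace K V)).
  intros eps.
  assert (he := cond_pos eps).
  destruct (pow_lt_1_zero r) with (y := eps / (4 * G + 1)) as [n hn].
  { rewrite Rabs_right; lra. }
  { apply Rdiv_lt_0_compat; lra. }
  specialize (hn n (le_n n)); rewrite Rabs_right in hn by (apply Rle_ge, hp).
  assert (hn' : 4 * G * r ^ n < eps).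
  { assert (h : (4 * G + 1) * r ^ n < eps).
    { replace (pos eps) with ((4 * G + 1) * (eps / (4 * G + 1))) by (field; lra).
      apply Rmult_lt_compat_l; lra. }
    assert (h1 := hp n); nra. }
  exists (fun p => (n <= fst p)%nat /\ (n <= snd p)%nat); split.
  - exists (fun m => (n <= m)%nat) (fun m => (n <= m)%nat); try (now exists n).
    intros i j hi' hj; split; assumption.
  - intros [m1 n1] [m2 n2] [h1 h2] [h3 h4]; cbn [fst snd] in *.
    fold (rect_sum a m1 n1); fold (rect_sum a m2 n2).
    apply (norm_compat1 (V := V)).
    eapply Rle_lt_trans; [apply norm_minus_triangle with (b := rect_sum a n n)|].
    assert (k1 := corner n m1 n1 h1 h2); assert (k2 := corner n m2 n2 h3 h4).
    rewrite (norm_minus_sym (rect_sum a n n)); lra.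
Qed.

(** * Absolute convergence *)

Lemma pow_exp (t : R) (n : nat) : exp t ^ n = exp (t * INR n).
Proof.
  induction n as [|n IH].
  - cbn; rewrite Rmult_0_r, exp_0; ring.
  - cbn [pow]; rewrite IH, <- exp_plus, S_INR; f_equal; ring.
Qed.

Lemma Cmod_pow_le_exp (x : C) (X : R) (n : nat) :
  0 < X -> Cmod x <= X -> Cmod (x ^ n) <= exp (ln X * INR n).
Proof.
  intros hX hx; rewrite Cmod_pow, <- pow_exp, exp_ln by exact hX.
  apply pow_incr; split; [apply Cmod_ge_0|exact hx].
Qed.

Lemma term_product_le (p1 p2 p3 p4 u p5 v p6 q1 q2 q3 q4 s q5 t q6 : R) :
  0 <= p1 <= q1 -> 0 <= p2 <= q2 -> 0 <= p3 <= q3 -> 0 <= p4 <= q4 ->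
  0 <= u <= s -> 0 <= p5 <= q5 -> 0 <= v <= t -> 0 <= p6 <= q6 ->
  p1 * p2 * p3 * p4 * (u * p5) * (v * p6) <= q1 * q2 * q3 * q4 * (s * q5) * (t * q6).
Proof.
  intros h1 h2 h3 h4 hu h5 hv h6.
  assert (comp : forall a b c d, 0 <= a <= c -> 0 <= b <= d -> 0 <= a * b <= c * d).
  { intros a b c d ha hb; split;
      [apply Rmult_le_pos|apply Rmult_le_compat]; apply ha || apply hb. }
  now repeat apply comp.
Qed.

(** The six factors are bounded separately, each with a sixth of [eps]; the
    factors of one index are lattice bounds on the axis [n = 0]. *)
Lemma term_upper_bound (g1 g2 g3 d1 d2 d3 : C) (a1 a2 a3 a4 b1 b2 b3 b4 eps : R) :
  0 < a1 -> 0 < a2 -> 0 < a3 -> 0 < a4 -> 0 < b1 -> 0 < b2 -> 0 < b3 -> 0 < b4 ->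
  0 < eps ->
  exists K, forall (x y : C) (X Y : R) (m n : nat),
    0 < X -> Cmod x <= X -> 0 < Y -> Cmod y <= Y ->
    Cmod (D1_term g1 g2 g3 d1 d2 d3 a1 a2 a3 a4 b1 b2 b3 b4 x y m n)
    <= exp (growth_exponent a1 a2 a3 a4 b1 b2 b3 b4 (INR m + 1) (INR n + 1)
         + ln X * INR m + ln Y * INR n + eps * (INR m + INR n) + K).
Proof.
  intros ha1 ha2 ha3 ha4 hb1 hb2 hb3 hb4 he.
  assert (he6 : 0 < eps / 6) by lra.
  destruct (poch_lattice g1 a1 b1 (a1 + b1) (eps / 6)) as [K1 k1]; try lra.
  destruct (poch_lattice g2 a2 1 a2 (eps / 6)) as [K2 k2]; try lra.
  destruct (poch_lattice g3 b2 1 b2 (eps / 6)) as [K3 k3]; try lra.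
  destruct (rGamma_lattice d1 a3 b3 (a3 + b3) (eps / 6)) as [K4 k4]; try lra.
  destruct (rGamma_lattice d2 a4 1 a4 (eps / 6)) as [K5 k5]; try lra.
  destruct (rGamma_lattice d3 b4 1 b4 (eps / 6)) as [K6 k6]; try lra.
  exists (K1 + K2 + K3 + K4 + K5 + K6); intros x y X Y m n hX hx hY hy.
  specialize (k1 m n); specialize (k4 m n).
  specialize (k2 m 0%nat); specialize (k5 m 0%nat);
  specialize (k3 n 0%nat); specialize (k6 n 0%nat).
  cbn [INR] in k2, k3, k5, k6; rewrite Rmult_0_r, !Rplus_0_r in k2, k3, k5, k6.
  assert (kx := Cmod_pow_le_exp x X m hX hx).
  assert (ky := Cmod_pow_le_exp y Y n hY hy).
  unfold D1_term; rewrite !Cmod_mult.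
  eapply Rle_trans.
  { exact (term_product_le _ _ _ _ _ _ _ _ _ _ _ _ _ _ _ _
      (conj (Cmod_ge_0 _) k1) (conj (Cmod_ge_0 _) k2) (conj (Cmod_ge_0 _) k3)
      (conj (Cmod_ge_0 _) k4) (conj (Cmod_ge_0 _) kx) (conj (Cmod_ge_0 _) k5)
      (conj (Cmod_ge_0 _) ky) (conj (Cmod_ge_0 _) k6)). }
  rewrite <- !exp_plus; apply exp_le.
  unfold growth_exponent.
  replace (a1 * (INR m + 1) + b1 * (INR n + 1))
    with (a1 * INR m + b1 * INR n + (a1 + b1)) by ring.
  replace (a3 * (INR m + 1) + b3 * (INR n + 1))
    with (a3 * INR m + b3 * INR n + (a3 + b3)) by ring.
  replace (a2 * (INR m + 1)) with (a2 * INR m + a2) by ring.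
  replace (a4 * (INR m + 1)) with (a4 * INR m + a4) by ring.
  replace (b2 * (INR n + 1)) with (b2 * INR n + b2) by ring.
  replace (b4 * (INR n + 1)) with (b4 * INR n + b4) by ring.
  assert (hm := pos_INR m); assert (hn := pos_INR n).
  assert (0 <= eps * INR m) by nra; assert (0 <= eps * INR n) by nra.
  lra.
Qed.

(** A quarter of the smaller decay rate is spent on the cross terms of the two
    tame bounds, another quarter on the error in Stirling's formula. *)
Lemma term_geometric (g1 g2 g3 d1 d2 d3 : C) (a1 a2 a3 a4 b1 b2 b3 b4 : R)
  (x y : C) (X Y : R) :
  0 < a1 -> 0 < a2 -> 0 < a3 -> 0 < a4 -> 0 < b1 -> 0 < b2 -> 0 < b3 -> 0 < b4 ->
  0 < X -> Cmod x <= X -> 0 < Y -> Cmod y <= Y ->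
  tame a1 a2 a3 a4 b1 b3 X -> tame b1 b2 b3 b4 a1 a3 Y ->
  exists B r, 0 <= B /\ 0 < r < 1 /\ forall m n,
    Cmod (D1_term g1 g2 g3 d1 d2 d3 a1 a2 a3 a4 b1 b2 b3 b4 x y m n) <= B * r ^ m * r ^ n.
Proof.
  intros ha1 ha2 ha3 ha4 hb1 hb2 hb3 hb4 hX hx hY hy (eta & he & h) (eta' & he' & h').
  set (e := Rmin eta eta' / 4).
  assert (hmin : 0 < e /\ 4 * e <= eta /\ 4 * e <= eta').
  { unfold e; assert (q1 := Rmin_l eta eta'); assert (q2 := Rmin_r eta eta').
    assert (q3 := Rmin_glb_lt eta eta' 0 he he'); lra. }
  destruct hmin as (e0 & e1 & e2).
  destruct (h e e0) as [K1 k1]; destruct (h' e e0) as [K2 k2].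
  destruct (term_upper_bound g1 g2 g3 d1 d2 d3 a1 a2 a3 a4 b1 b2 b3 b4 e) as [K k];
    try assumption.
  exists (exp (K + K1 + K2 - ln X - ln Y)), (exp (- 2 * e)).
  split; [apply Rlt_le, exp_pos|split].
  - split; [apply exp_pos|]; rewrite <- exp_0; apply exp_increasing; lra.
  - intros m n; eapply Rle_trans; [apply (k x y X Y m n); assumption|].
    assert (hm := pos_INR m); assert (hn := pos_INR n).
    rewrite !pow_exp, <- !exp_plus; apply exp_le.
    rewrite growth_exponent_eq by (assumption || lra).
    specialize (k1 (INR m + 1) (INR n + 1) ltac:(lra) ltac:(lra)).
    specialize (k2 (INR n + 1) (INR m + 1) ltac:(lra) ltac:(lra)).
    assert (eta * (INR m + 1) >= 4 * e * (INR m + 1)) by nra.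
    assert (eta' * (INR n + 1) >= 4 * e * (INR n + 1)) by nra.
    assert (0 <= e * INR m) by nra; assert (0 <= e * INR n) by nra.
    nra.
Qed.

Lemma D1_converges (g1 g2 g3 d1 d2 d3 : C) (a1 a2 a3 a4 b1 b2 b3 b4 : R)
  (x y : C) (X Y : R) :
  0 < a1 -> 0 < a2 -> 0 < a3 -> 0 < a4 -> 0 < b1 -> 0 < b2 -> 0 < b3 -> 0 < b4 ->
  0 < X -> Cmod x <= X -> 0 < Y -> Cmod y <= Y ->
  tame a1 a2 a3 a4 b1 b3 X -> tame b1 b2 b3 b4 a1 a3 Y ->
  ex_double_series (D1_term g1 g2 g3 d1 d2 d3 a1 a2 a3 a4 b1 b2 b3 b4 x y) /\
  abs_cv_double_series (D1_term g1 g2 g3 d1 d2 d3 a1 a2 a3 a4 b1 b2 b3 b4 x y).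
Proof.
  intros ha1 ha2 ha3 ha4 hb1 hb2 hb3 hb4 hX hx hY hy h h'.
  destruct (term_geometric g1 g2 g3 d1 d2 d3 a1 a2 a3 a4 b1 b2 b3 b4 x y X Y)
    as (B & r & hB & hr & hle); try assumption.
  split.
  - exact (ex_double_series_geom (V := C_CompleteNormedModule) _ B r hB hr hle).
  - apply (ex_double_series_geom (V := R_CompleteNormedModule) _ B r hB hr).
    intros m n; unfold norm; cbn; unfold abs; cbn.
    rewrite Rabs_right by (apply Rle_ge, Cmod_ge_0); apply hle.
Qed.

(** * Divergence *)

(** For [c = 0] both sides vanish because [Phi 0 = 0]; this lets the rays include
    the axes. *)
Lemma Phi_scale (c k : R) : 0 <= c -> 0 < k -> Phi (c * k) = c * (k * ln k) + k * Phi c.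
Proof.
  intros hc hk; unfold Phi; destruct (Req_dec c 0) as [h|h].
  - rewrite h; ring.
  - rewrite ln_mult by lra; ring.
Qed.

Lemma Cmod_pow_ray (x : C) (p : nat) : (x <> RtoC 0 \/ p = 0%nat) ->
  exists u, forall k, Cmod (x ^ (p * k)) = exp (u * INR k).
Proof.
  intros [hx|hp].
  - assert (h : 0 < Cmod (x ^ p)) by (apply Cmod_gt_0; now apply Cpow_nz).
    exists (ln (Cmod (x ^ p))); intros k.
    rewrite <- pow_exp, exp_ln, Cpow_mult_r, Cmod_pow by exact h; reflexivity.
  - exists 0; intros k; rewrite hp, Rmult_0_l, exp_0; cbn; apply Cmod_1.
Qed.

(** On the ray the six [Phi]'s contribute [D k ln k + O(k)] with
    [D = - (Delta p + Delta' q) > 0]; all other contributions are [O(k)]. *)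
Lemma term_ray_lower (g1 g2 g3 d1 d2 d3 : C) (a1 a2 a3 a4 b1 b2 b3 b4 : R)
  (x y : C) (p q : nat) :
  0 < a1 -> 0 < a2 -> 0 < a3 -> 0 < a4 -> 0 < b1 -> 0 < b2 -> 0 < b3 -> 0 < b4 ->
  ~ nonpos_int g1 -> ~ nonpos_int g2 -> ~ nonpos_int g3 ->
  ~ nonpos_int d2 -> ~ nonpos_int d3 ->
  a3 + a4 - a1 - a2 < 0 -> b3 + b4 - b1 - b2 < 0 ->
  (0 < p + q)%nat -> (x <> RtoC 0 \/ p = 0%nat) -> (y <> RtoC 0 \/ q = 0%nat) ->
  eventually (fun k =>
    1 <= Cmod (D1_term g1 g2 g3 d1 d2 d3 a1 a2 a3 a4 b1 b2 b3 b4 x y (p * k) (q * k))).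
Proof.
  intros ha1 ha2 ha3 ha4 hb1 hb2 hb3 hb4 hg1 hg2 hg3 hd2 hd3 hD hD' hpq hx hy.
  assert (hp := pos_INR p); assert (hq := pos_INR q).
  assert (hpq' : 0 < INR p + INR q) by (rewrite <- plus_INR; now apply lt_0_INR).
  assert (pos : forall s t, 0 < s -> 0 < t -> 0 < s * INR p + t * INR q).
  { intros s t hs ht; destruct (Req_dec (INR p) 0) as [h|h].
    - rewrite h in *; assert (0 < t * INR q) by (apply Rmult_lt_0_compat; lra); lra.
    - assert (0 < s * INR p) by (apply Rmult_lt_0_compat; lra).
      assert (0 <= t * INR q) by (apply Rmult_le_pos; lra); lra. }
  set (l1 := a1 * INR p + b1 * INR q); set (l2 := a2 * INR p); set (l3 := b2 * INR q).
  set (l4 := a3 * INR p + b3 * INR q); set (l5 := a4 * INR p); set (l6 := b4 * INR q).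
  assert (h1 : 0 <= l1) by (unfold l1; nra).
  assert (h2 : 0 <= l2) by (unfold l2; nra).
  assert (h3 : 0 <= l3) by (unfold l3; nra).
  assert (h4 : 0 < l4) by (now apply pos).
  assert (h5 : 0 <= l5) by (unfold l5; nra).
  assert (h6 : 0 <= l6) by (unfold l6; nra).
  destruct (poch_ray_lower g1 l1 1 h1 hg1 Rlt_0_1) as (K1 & N1 & k1).
  destruct (poch_ray_lower g2 l2 1 h2 hg2 Rlt_0_1) as (K2 & N2 & k2).
  destruct (poch_ray_lower g3 l3 1 h3 hg3 Rlt_0_1) as (K3 & N3 & k3).
  destruct (rGamma_ray_lower d1 l4 1 (Rlt_le _ _ h4)
    ltac:(intros e; exfalso; lra) Rlt_0_1) as (K4 & N4 & k4).
  destruct (rGamma_ray_lower d2 l5 1 h5 (fun _ => hd2) Rlt_0_1) as (K5 & N5 & k5).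
  destruct (rGamma_ray_lower d3 l6 1 h6 (fun _ => hd3) Rlt_0_1) as (K6 & N6 & k6).
  destruct (Cmod_pow_ray x p hx) as [u hu]; destruct (Cmod_pow_ray y q hy) as [v hv].
  set (D := l1 + l2 + l3 - l4 - l5 - l6).
  assert (hDpos : 0 < D).
  { unfold D, l1, l2, l3, l4, l5, l6.
    replace (_ - _) with (- (a3 + a4 - a1 - a2) * INR p + - (b3 + b4 - b1 - b2) * INR q)
      by ring. apply pos; lra. }
  set (Q := Phi l1 + Phi l2 + Phi l3 - Phi l4 - Phi l5 - Phi l6 + u + v - 6).
  set (K := K1 + K2 + K3 + K4 + K5 + K6).
  (* once [ln k >= t], the exponent is at least [k |K| - K >= 0] *)
  set (t := (Rabs K - Q) / D).
  destruct (nfloor_ex (exp t)) as [N0 hN0]; [apply Rlt_le, exp_pos|].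
  exists (S N0 + N1 + N2 + N3 + N4 + N5 + N6)%nat; intros k hk.
  specialize (k1 k ltac:(lia)); specialize (k2 k ltac:(lia)); specialize (k3 k ltac:(lia)).
  specialize (k4 k ltac:(lia)); specialize (k5 k ltac:(lia)); specialize (k6 k ltac:(lia)).
  assert (hk1 : INR N0 + 1 <= INR k) by (rewrite <- S_INR; apply le_INR; lia).
  assert (hN := pos_INR N0).
  assert (hk0 : 0 < INR k) by lra.
  rewrite Phi_scale in k1, k2, k3, k4, k5, k6 by lra.
  assert (hlk : t <= ln (INR k)).
  { rewrite <- (ln_exp t); apply ln_le; [apply exp_pos|lra]. }
  unfold D1_term; rewrite !Cmod_mult, !mult_INR.
  replace (a1 * (INR p * INR k) + b1 * (INR q * INR k)) with (l1 * INR k)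
    by (unfold l1; ring).
  replace (a3 * (INR p * INR k) + b3 * (INR q * INR k)) with (l4 * INR k)
    by (unfold l4; ring).
  rewrite <- !(Rmult_assoc a2), <- !(Rmult_assoc a4), <- !(Rmult_assoc b2),
    <- !(Rmult_assoc b4).
  fold l2 l3 l5 l6; rewrite hu, hv.
  assert (bound : forall w z : R, exp w <= z -> 0 <= exp w <= z)
    by (intros w z h; split; [apply Rlt_le, exp_pos|exact h]).
  eapply Rle_trans; [|exact (term_product_le _ _ _ _ _ _ _ _ _ _ _ _ _ _ _ _
    (bound _ _ k1) (bound _ _ k2) (bound _ _ k3) (bound _ _ k4)
    (bound _ _ (Rle_refl _)) (bound _ _ k5) (bound _ _ (Rle_refl _)) (bound _ _ k6))].
  rewrite <- !exp_plus.
  apply Rle_trans with (exp 0); [rewrite exp_0; apply Rle_refl|apply exp_le].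
  apply Rle_trans with (INR k * (D * ln (INR k) + Q) - K); [|unfold D, Q, K; lra].
  assert (e : D * t + Q = Rabs K) by (unfold t; field; lra).
  assert (hKk : Rabs K <= D * ln (INR k) + Q) by (rewrite <- e; nra).
  assert (hK := Rle_abs K); assert (hK' := Rabs_pos K).
  nra.
Qed.

Lemma D1_term_x0 (g1 g2 g3 d1 d2 d3 : C) (a1 a2 a3 a4 b1 b2 b3 b4 : R) (y : C) (m n : nat) :
  D1_term g1 g2 g3 d1 d2 d3 a1 a2 a3 a4 b1 b2 b3 b4 (RtoC 0) y (S m) n = RtoC 0.
Proof. unfold D1_term; rewrite Cpow_S; ring. Qed.

Lemma D1_term_y0 (g1 g2 g3 d1 d2 d3 : C) (a1 a2 a3 a4 b1 b2 b3 b4 : R) (x : C) (m n : nat) :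
  D1_term g1 g2 g3 d1 d2 d3 a1 a2 a3 a4 b1 b2 b3 b4 x (RtoC 0) m (S n) = RtoC 0.
Proof. unfold D1_term; rewrite Cpow_S; ring. Qed.

Lemma sum_n_head (u : nat -> C) (N : nat) :
  (forall k, u (S k) = RtoC 0) -> sum_n u N = u 0%nat.
Proof.
  intros h; induction N as [|N IH]; [apply sum_O|].
  rewrite sum_Sn, IH, h; exact (Cplus_0_r _).
Qed.

(** With one variable zero, only one column or one row of terms is left, and
    its entries are row or column sums.  With both nonzero, a term far out on the
    diagonal is a difference of two partial sums of the same row. *)
Lemma D1_diverges (g1 g2 g3 d1 d2 d3 : C) (a1 a2 a3 a4 b1 b2 b3 b4 : R)
  (x y : C) :
  0 < a1 -> 0 < a2 -> 0 < a3 -> 0 < a4 -> 0 < b1 -> 0 < b2 -> 0 < b3 -> 0 < b4 ->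
  ~ nonpos_int g1 -> ~ nonpos_int g2 -> ~ nonpos_int g3 ->
  ~ nonpos_int d2 -> ~ nonpos_int d3 ->
  a3 + a4 - a1 - a2 < 0 -> b3 + b4 - b1 - b2 < 0 ->
  x <> RtoC 0 \/ y <> RtoC 0 ->
  ~ ex_double_series (D1_term g1 g2 g3 d1 d2 d3 a1 a2 a3 a4 b1 b2 b3 b4 x y).
Proof.
  intros ha1 ha2 ha3 ha4 hb1 hb2 hb3 hb4 hg1 hg2 hg3 hd2 hd3 hD hD' hxy hs.
  set (a := D1_term g1 g2 g3 d1 d2 d3 a1 a2 a3 a4 b1 b2 b3 b4 x y) in *.
  assert (ray : forall p q, (0 < p + q)%nat -> (x <> RtoC 0 \/ p = 0%nat) ->
    (y <> RtoC 0 \/ q = 0%nat) ->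
    eventually (fun k => 1 <= Cmod (a (p * k)%nat (q * k)%nat))).
  { intros p q; now apply term_ray_lower. }
  destruct (double_series_tails a hs (1 / 2)) as [N hN]; [lra|].
  destruct (excluded_middle_informative (x = RtoC 0)) as [hx|hx].
  - destruct hxy as [h|hy]; [tauto|].
    destruct (ray 0%nat 1%nat) as [M hM]; auto.
    specialize (hM (N + M)%nat ltac:(lia)); rewrite Nat.mul_0_l, Nat.mul_1_l in hM.
    destruct (hN N (N + M)%nat) as [_ h]; try lia.
    rewrite sum_n_head in h by (intros k; unfold a; rewrite hx; apply D1_term_x0).
    change (Cmod (a 0%nat (N + M)%nat) < 1 / 2) in h; lra.
  - destruct (excluded_middle_informative (y = RtoC 0)) as [hy|hy].
    + destruct (ray 1%nat 0%nat) as [M hM]; auto.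
      specialize (hM (N + M)%nat ltac:(lia)); rewrite Nat.mul_0_l, Nat.mul_1_l in hM.
      destruct (hN (N + M)%nat N) as [h _]; try lia.
      rewrite sum_n_head in h by (intros k; unfold a; rewrite hy; apply D1_term_y0).
      change (Cmod (a (N + M)%nat 0%nat) < 1 / 2) in h; lra.
    + destruct (ray 1%nat 1%nat) as [M hM]; auto.
      specialize (hM (S N + M)%nat ltac:(lia)); rewrite Nat.mul_1_l in hM.
      destruct (hN (S N + M)%nat (S N + M)%nat) as [h1 _]; try lia.
      destruct (hN (S N + M)%nat (N + M)%nat) as [h2 _]; try lia.
      replace (S N + M)%nat with (S (N + M)) in * by lia.
      rewrite sum_Sn in h1.
      change (Cmod (sum_n (a (S (N + M))) (N + M) + a (S (N + M)) (S (N + M)))%C < 1 / 2) in h1.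
      change (Cmod (sum_n (a (S (N + M))) (N + M)) < 1 / 2) in h2.
      set (s := sum_n _ _) in h1, h2; set (t := a _ _) in h1, hM.
      assert (h3 : Cmod t <= Cmod (s + t)%C + Cmod s); [|lra].
      rewrite <- (Cmod_opp s); replace t with (s + t + - s)%C at 1 by ring.
      apply Cmod_triangle.
Qed.

Lemma ex_double_series_origin (g1 g2 g3 d1 d2 d3 : C) (a1 a2 a3 a4 b1 b2 b3 b4 : R) :
  ex_double_series (D1_term g1 g2 g3 d1 d2 d3 a1 a2 a3 a4 b1 b2 b3 b4 (RtoC 0) (RtoC 0)).
Proof.
  set (a := D1_term _ _ _ _ _ _ _ _ _ _ _ _ _ _ _ _).
  exists (a 0%nat 0%nat).
  apply filterlim_ext with (fun _ => a 0%nat 0%nat); [|apply filterlim_const].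
  intros [M N]; cbn [fst snd].
  assert (e : forall m, sum_n (a m) N = a m 0%nat)
    by (intros m; apply sum_n_head; intros k; apply D1_term_y0).
  symmetry; refine (eq_trans (sum_n_ext _ (fun m => a m 0%nat) M e) _).
  apply (sum_n_head (fun m => a m 0%nat)); intros k; apply D1_term_x0.
Qed.

(** * Regions of convergence *)

Theorem mainTheorem1
  (gamma1 gamma2 gamma3 delta1 delta2 delta3 : C)
  (alpha1 alpha2 alpha3 alpha4 beta1 beta2 beta3 beta4 : R)
  (ha1 : 0 < alpha1) (ha2 : 0 < alpha2) (ha3 : 0 < alpha3) (ha4 : 0 < alpha4)
  (hb1 : 0 < beta1) (hb2 : 0 < beta2) (hb3 : 0 < beta3) (hb4 : 0 < beta4) :
  let term := D1_term gamma1 gamma2 gamma3 delta1 delta2 delta3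
                alpha1 alpha2 alpha3 alpha4 beta1 beta2 beta3 beta4 in
  let Delta := alpha3 + alpha4 - alpha1 - alpha2 in
  let Delta' := beta3 + beta4 - beta1 - beta2 in
  let rho := inf_pos_quadrant (E alpha1 alpha2 alpha3 alpha4 beta1 beta3) in
  let rho' := inf_pos_quadrant (E' alpha1 alpha3 beta1 beta2 beta3 beta4) in
  (0 < Delta -> 0 < Delta' ->
     forall x y : C, ex_double_series (term x y))
  /\ (Delta = 0 -> Delta' = 0 ->
     forall x y : C, Rbar_lt (Cmod x) rho -> Rbar_lt (Cmod y) rho' ->
       abs_cv_double_series (term x y))
  /\ (~ nonpos_int gamma1 -> ~ nonpos_int gamma2 -> ~ nonpos_int gamma3 ->
      ~ nonpos_int delta2 -> ~ nonpos_int delta3 ->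
      Delta < 0 -> Delta' < 0 ->
     forall x y : C,
       ex_double_series (term x y) <-> (x = RtoC 0 /\ y = RtoC 0))
  /\ (Delta = 0 -> 0 < Delta' ->
     forall x y : C, Rbar_lt (Cmod x) rho ->
       abs_cv_double_series (term x y))
  /\ (0 < Delta -> Delta' = 0 ->
     forall x y : C, Rbar_lt (Cmod y) rho' ->
       abs_cv_double_series (term x y)).
Proof.
  intros term Delta Delta' rho rho'.
  set (xtame := fun x : C => exists X, 0 < X /\ Cmod x <= X /\
    tame alpha1 alpha2 alpha3 alpha4 beta1 beta3 X).
  set (ytame := fun y : C => exists Y, 0 < Y /\ Cmod y <= Y /\
    tame beta1 beta2 beta3 beta4 alpha1 alpha3 Y).
  assert (xpos : 0 < Delta -> forall x, xtame x).
  { intros h x; exists (Cmod x + 1); assert (hc := Cmod_ge_0 x).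
    split; [lra|split; [lra|now apply tame_of_pos]]. }
  assert (ypos : 0 < Delta' -> forall y, ytame y).
  { intros h y; exists (Cmod y + 1); assert (hc := Cmod_ge_0 y).
    split; [lra|split; [lra|now apply tame_of_pos]]. }
  assert (xzero : Delta = 0 -> forall x : C, Rbar_lt (Cmod x) rho -> xtame x).
  { intros h x hx.
    destruct (radius_gap _ x (E_pos alpha1 alpha2 alpha3 alpha4 beta1 beta3) hx)
      as (X & eta & h1 & h2 & h3 & h4).
    exists X; split; [exact h1|split; [exact h2|]].
    exact (tame_of_lt _ _ _ _ _ _ _ _ h h3 h4). }
  assert (yzero : Delta' = 0 -> forall y : C, Rbar_lt (Cmod y) rho' -> ytame y).
  { intros h y hy.
    destruct (radius_gap (E' alpha1 alpha3 beta1 beta2 beta3 beta4) y)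
      as (Y & eta & h1 & h2 & h3 & h4).
    { intros mu nu; rewrite E'_swap; apply E_pos. }
    { exact hy. }
    exists Y; split; [exact h1|split; [exact h2|]].
    apply (tame_of_lt _ _ _ _ _ _ _ _ h h3).
    intros nu mu hnu hmu; rewrite <- E'_swap; now apply h4. }
  assert (cv : forall x y, xtame x -> ytame y ->
    ex_double_series (term x y) /\ abs_cv_double_series (term x y)).
  { intros x y (X & h1 & h2 & h3) (Y & h4 & h5 & h6).
    now apply D1_converges with X Y. }
  split; [|split; [|split; [|split]]].
  - intros h h' x y; apply cv; auto.
  - intros h h' x y hx hy; apply cv; auto.
  - intros hg1 hg2 hg3 hd2 hd3 h h' x y; split.
    + intros hs.
      destruct (classic (x = RtoC 0 /\ y = RtoC 0)) as [hxy|hxy]; [exact hxy|].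
      exfalso; revert hs; apply D1_diverges; try assumption.
      apply not_and_or in hxy; exact hxy.
    + intros [hx hy]; rewrite hx, hy; apply ex_double_series_origin.
  - intros h h' x y hx; apply cv; auto.
  - intros h h' x y hy; apply cv; auto.
Qed.
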